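(* Let $\mathcal X=\mathbb R^n$ and consider the family of problems $\{\mathbf P_\lambda\}_{\lambda>0}$, $\min_{\mathbf x\in\mathcal X}F(\mathbf x;\lambda)=f(\mathbf x)+\gamma(\lambda)p(\mathbf x)$, together with a family of initializations $\{\mathbf x_0(\lambda)\}_{\lambda>0}\subset\mathcal X$. Suppose that all of the following assumptions, defined in the context, hold: LDP of target risk, unbiased and efficient gradient estimators, safe start (for $\{\mathbf x_0(\lambda)\}$), smoothness and convexity of the average-case loss, sublevel-boundedness, zero minimum of the average-case loss, relative gradient and Hessian bounds, convexity of the combined objective, and sub-exponential initial distance (for $\{\mathbf x_0(\lambda)\}$). Then, for any fixed $\alpha\in[0,1)$ and for either choice of class $\mathbb A\in\{\mathbb A_{\alpha,\mathrm{last}},\mathbb A_{\alpha,\mathrm{avg}}\}$, there exists a family of SGD schemes $\{\mathcal A(\lambda)\}_{\lambda>0}\subset\mathbb A$ such that the family of configurations $\{(\mathcal A(\lambda),\mathbf x_0(\lambda))\}_{\lambda>0}$ is efficient, i.e. for every $\varepsilon>0$ and every $\kappa\in(0,1)$, $$\limsup_{\lambda\to\infty}\frac1\lambda\log T^{\varepsilon,\kappa}_\lambda\big(\mathcal A(\lambda),\mathbf x_0(\lambda)\big)\le 0 .$$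
   Context: Setting. $\mathcal X\subseteq\mathbb R^n$ is the feasible set, $f:\mathcal X\to\mathbb R$ the average-case loss, $p:\mathcal X\to[0,\infty)$ the extreme risk, $\gamma(\lambda)>0$ a weight for each rarity level $\lambda>0$ ($f,p,\mathcal X$ do not depend on $\lambda$). $F(\mathbf x;\lambda)=f(\mathbf x)+\gamma(\lambda)p(\mathbf x)$; $\mathbf x^*(\lambda)$ is a minimizer of $F(\cdot;\lambda)$ over $\mathcal X$; $p^*(\lambda)=p(\mathbf x^*(\lambda))$. Convention: $\log 0=-\infty$. $\|\cdot\|$ is the Euclidean (or spectral) norm. Assumptions. (i) LDP of target risk: there is $I>0$ with $\lim_{\lambda\to\infty}\frac1\lambda\log p^*(\lambda)=-I$ and $\limsup_{\lambda\to\infty}\frac1\lambda\log\gamma(\lambda)=I$. (ii) Unbiased and efficient gradient estimators: for each $\lambda>0$ there are unbiased estimators $G_f(\mathbf x,\xi)$, $G_p(\mathbf x,\xi;\lambda)$ of $\nabla f(\mathbf x)$, $\nabla p(\mathbf x)$ ($\xi$ random), a constant $\sigma_f\ge0$ and $\sigma_p(\lambda)\ge0$ such that for all $\mathbf x\in\mathcal X$: $\mathbb E\|G_f(\mathbf x,\xi)-\nabla f(\mathbf x)\|^2\le\sigma_f^2$ and $\mathbb E\|G_p(\mathbf x,\xi;\lambda)-\nabla p(\mathbf x)\|^2\le\sigma_p^2(\lambda)\|\nabla p(\mathbf x)\|^2$, with $\limsup_{\lambda\to\infty}\frac1\lambda\log\sigma_p(\lambda)\le0$. (iii) Safe start: with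 $I$ from (i), $\limsup_{\lambda\to\infty}\frac1\lambda\log p(\mathbf x_0(\lambda))\le -I$. (iv) Smoothness and convexity of the average-case loss: $\mathcal X$ is convex, closed, nonempty; $f$ is twice continuously differentiable, convex, and $\|\nabla^2f(\mathbf x)\|\le L_f$ on $\mathcal X$ for some $L_f>0$. (v) Sublevel-boundedness: there are $\epsilon_f,d_f>0$ such that $\{\mathbf x\in\mathcal X: f(\mathbf x)\le\epsilon_f\}$ is nonempty with diameter at most $d_f$. (Hence $f$ has a minimizer $\tilde{\mathbf x}^*$ over $\mathcal X$, which is fixed.) (vi) Zero minimum of the average-case loss: $f(\tilde{\mathbf x}^* )=0$. (vii) Relative gradient and Hessian bounds: $p:\mathcal X\to[0,\infty)$ is twice continuously differentiable and there are $L_{p,1},L_{p,2}>0$, $\beta_1,\beta_2\ge0$ with $\|\nabla p(\mathbf x)\|\le L_{p,1}(1+\|\mathbf x-\tilde{\mathbf x}^*\|^{\beta_1})p(\mathbf x)$ and $\|\nabla^2p(\mathbf x)\|\le L_{p,2}(1+\|\mathbf x-\tilde{\mathbf x}^*\|^{\beta_2})p(\mathbf x)$ for all $\mathbf x\in\mathcal X$. (viii) Convexity of the combined objective: $F(\cdot;\lambda)$ is convex on $\mathcal X$ for every $\lambda>0$. (ix) Sub-exponential initial distance: $\limsup_{\lambda\to\infty}\frac1\lambda\log\|\mathbf x_0(\lambda)-\tilde{\mathbf x}^*\|\le0$. SGD. Given step sizes $\eta_t>0$ and a mini-batch size $B\ge1$, $\mathbf x_{t+1}=\Pi_{\mathcal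 X}(\mathbf x_t-\eta_t\bar G_t)$, $\bar G_t=\frac1B\sum_{i=1}^B\big(G_f(\mathbf x_t,\xi_{t,i})+\gamma(\lambda)G_p(\mathbf x_t,\xi_{t,i};\lambda)\big)$, with $\xi_{t,i}$ i.i.d. and $\Pi_{\mathcal X}$ the Euclidean projection. A scheme $\mathcal A$ specifies deterministic step sizes, the constant mini-batch size $B$, and the output after $T$ iterations. $\mathbb A_{\alpha,\mathrm{last}}$ (resp. $\mathbb A_{\alpha,\mathrm{avg}}$) is the class of schemes with $\eta_t=\eta_0(1+t)^{-\alpha}$ for some $\eta_0>0$, any $B\ge1$, and output $\mathbf x_T$ (resp. $\bar{\mathbf x}_T=\sum_{t=0}^{T-1}\eta_t\mathbf x_{t+1}/\sum_{t=0}^{T-1}\eta_t$). For $T=0$ the output is $\mathbf x_0$. A configuration is a pair $(\mathcal A,\mathbf x_0)$ of a scheme and an initial point. Sampling complexity. $T^{\varepsilon,\kappa}_\lambda(\mathcal A,\mathbf x_0)$ is the minimum number $T\cdot B$ of stochastic gradient samples such that the output $\hat{\mathbf x}$ after $T$ iterations satisfies $F(\hat{\mathbf x};\lambda)\le(1+\varepsilon)F(\mathbf x^*(\lambda);\lambda)$ with probability at least $1-\kappa$ ($+\infty$ if there is none). *)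

(* Defs.v *)
From HB Require Import structures.
From mathcomp Require Import all_boot all_order all_algebra finmap.
From mathcomp Require Import all_classical all_reals all_analysis.

Set Implicit Arguments.
Unset Strict Implicit.
Unset Printing Implicit Defensive.

Import Order.TTheory GRing.Theory Num.Theory.
Import numFieldNormedType.Exports.

Local Open Scope classical_set_scope.
Local Open Scope ring_scope.

Section Euclidean.
Variables (R : realType) (n : nat).

(* The norm [`|x|] that the library puts on ['rV[R]_n] is the sup norm; it
   induces the same topology (hence the same derivatives). *)
Definition enorm (x : 'rV[R]_n) : R := Num.sqrt (\sum_(i < n) x 0 i ^+ 2).

Definition specnorm (A : 'M[R]_n) : R :=
  sup [set enorm (v *m A) | v in [set v : 'rV[R]_n | enorm v <= 1]].

Definition grad (f : 'rV[R]_n -> R) (x : 'rV[R]_n) : 'rV[R]_n :=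
  \row_(i < n) 'D_(delta_mx 0 i) f x.

Definition hess (f : 'rV[R]_n -> R) (x : 'rV[R]_n) : 'M[R]_n :=
  jacobian (grad f) x.

Definition twice_cont_diff (f : 'rV[R]_n -> R) : Prop :=
  [/\ forall x, differentiable f x,
      forall x, differentiable (grad f) x
    & continuous (hess f)].

Definition is_minimizer (X : set 'rV[R]_n) (g : 'rV[R]_n -> R)
    (x : 'rV[R]_n) : Prop :=
  X x /\ forall y, X y -> g x <= g y.

(* Euclidean projection; the default value 0 is only reached when [y] has no
   nearest point in [X]. *)
Definition proj (X : set 'rV[R]_n) (y : 'rV[R]_n) : 'rV[R]_n :=
  xget 0 [set z | is_minimizer X (fun w => enorm (y - w)) z].

(* With respect to the Borel sigma-algebra on R^n; this is what makes the SGD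
   iterates below random variables. *)
Definition jointly_measurable d (S : measurableType d)
    (G : 'rV[R]_n -> S -> 'rV[R]_n) : Prop :=
  forall i : 'I_n,
    measurable_fun [set: g_sigma_algebraType (@open 'rV[R]_n) * S]
                   (fun z => G z.1 z.2 0 i).

Definition unbiased d (S : measurableType d) (mu : probability S R)
    (G : S -> 'rV[R]_n) (v : 'rV[R]_n) : Prop :=
  forall i : 'I_n,
    mu.-integrable [set: S] (fun s => (G s 0 i)%:E) /\
    ('E_mu[(fun s => G s 0 i)%R] = (v 0 i)%:E)%E.

End Euclidean.

(* [lne] satisfies [lne 0 = -oo] and [lne +oo = +oo]. *)
Definition log_rate (R : realType) (g : R -> \bar R) (l : R) : \bar R :=
  ((l^-1)%:E * lne (g l))%E.

Definition limsup_log_rate (R : realType) (g : R -> \bar R) : \bar R :=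
  limf_esup (log_rate g) (pinfty_nbhs R).

Section Probability.
Variables (R : realType) (d d' : measure_display).
Variables (Omega : measurableType d) (S : measurableType d').

Definition mutually_independent (P : probability Omega R) (J : choiceType)
    (xi : J -> Omega -> S) : Prop :=
  forall (K : {fset J}) (A : J -> set S), (forall j, measurable (A j)) ->
    P (\bigcap_(j in [set` K]) (xi j @^-1` A j)) =
    (\prod_(j <- K) P (xi j @^-1` A j))%E.

Definition iid (P : probability Omega R) (mu : probability S R)
    (J : choiceType) (xi : J -> Omega -> S) : Prop :=
  [/\ forall j, measurable_fun [set: Omega] (xi j),
      forall j (A : set S), measurable A -> P (xi j @^-1` A) = mu A
    & mutually_independent P xi].

End Probability.

Section Assumptions.
Variables (R : realType) (n : nat).
Implicit Types (f p : 'rV[R]_n -> R) (gamma : R -> R) (x : 'rV[R]_n).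

Definition objective f p gamma (l : R) x : R := f x + gamma l * p x.

Definition ldp_target_risk p gamma (xstar : R -> 'rV[R]_n) (I : R) : Prop :=
  [/\ 0 < I,
      log_rate (fun l => (p (xstar l))%:E) l @[l --> +oo] --> (- I)%:E
    & limsup_log_rate (fun l => (gamma l)%:E) = I%:E].

(* [mu l] is the law of the random input used at rarity level [l]; since it may
   depend on [l], so may the input space (take a disjoint union). *)
Definition efficient_estimators f p d (S : measurableType d)
    (mu : R -> probability S R) (Gf : 'rV[R]_n -> S -> 'rV[R]_n)
    (Gp : R -> 'rV[R]_n -> S -> 'rV[R]_n) : Prop :=
  [/\ jointly_measurable Gf,
      forall l : R, 0 < l -> jointly_measurable (Gp l),
      forall (l : R) (x : 'rV[R]_n), 0 < l -> unbiased (mu l) (Gf x) (grad f x),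
      forall (l : R) (x : 'rV[R]_n), 0 < l -> unbiased (mu l) (Gp l x) (grad p x)
    & exists (sf : R) (sp : R -> R),
      [/\ 0 <= sf,
          forall l : R, 0 < l -> 0 <= sp l,
          forall (l : R) (x : 'rV[R]_n), 0 < l ->
            ('E_(mu l)[(fun s => enorm (Gf x s - grad f x) ^+ 2)%R]
               <= (sf ^+ 2)%:E)%E,
          forall (l : R) (x : 'rV[R]_n), 0 < l ->
            ('E_(mu l)[(fun s => enorm (Gp l x s - grad p x) ^+ 2)%R]
               <= (sp l ^+ 2 * enorm (grad p x) ^+ 2)%:E)%E
        & (limsup_log_rate (fun l => (sp l)%:E) <= 0)%E]].

Definition safe_start p (x0 : R -> 'rV[R]_n) (I : R) : Prop :=
  (limsup_log_rate (fun l => (p (x0 l))%:E) <= (- I)%:E)%E.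

(* The whole space is convex, closed and nonempty, so nothing is required of
   the feasible set. *)
Definition smooth_convex_loss f : Prop :=
  [/\ twice_cont_diff f,
      convex_function [set: 'rV[R]_n] f
    & exists2 Lf : R, 0 < Lf & forall x, specnorm (hess f x) <= Lf].

Definition sublevel_bounded f : Prop :=
  exists epsf df : R,
    [/\ 0 < epsf, 0 < df, exists x, f x <= epsf
      & forall x y, f x <= epsf -> f y <= epsf -> enorm (x - y) <= df].

Definition relative_bounds p (xt : 'rV[R]_n) : Prop :=
  twice_cont_diff p /\
  exists L1 L2 b1 b2 : R,
    [/\ 0 < L1, 0 < L2, 0 <= b1 & 0 <= b2] /\
    forall x,
      enorm (grad p x) <= L1 * (1 + enorm (x - xt) `^ b1) * p x /\
      specnorm (hess p x) <= L2 * (1 + enorm (x - xt) `^ b2) * p x.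

Definition convex_objective f p gamma : Prop :=
  forall l : R, 0 < l -> convex_function [set: 'rV[R]_n] (objective f p gamma l).

Definition subexp_initial_distance (x0 : R -> 'rV[R]_n) (xt : 'rV[R]_n) : Prop :=
  (limsup_log_rate (fun l => (enorm (x0 l - xt))%:E) <= 0)%E.

End Assumptions.

Section SGD.
Variables (R : realType) (n : nat).

(* [output A x T] is the output after [T] iterations as a function of the
   trajectory [x]. *)
Record scheme := Scheme {
  stepsize : nat -> R;
  batch : nat;
  output : (nat -> 'rV[R]_n) -> nat -> 'rV[R]_n }.

Definition poly_steps (alpha : R) (A : scheme) : Prop :=
  exists2 eta0 : R, 0 < eta0 &
    stepsize A = (fun t : nat => eta0 * (1 + t%:R) `^ (- alpha)).

Definition last_output (x : nat -> 'rV[R]_n) (T : nat) : 'rV[R]_n := x T.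

Definition avg_output (eta : nat -> R) (x : nat -> 'rV[R]_n) (T : nat) :
    'rV[R]_n :=
  if T == 0%N then x 0%N
  else (\sum_(t < T) eta t)^-1 *: \sum_(t < T) eta t *: x t.+1.

Definition class_last (alpha : R) : set scheme := [set A |
  [/\ poly_steps alpha A, (1 <= batch A)%N & output A = last_output]].

Definition class_avg (alpha : R) : set scheme := [set A |
  [/\ poly_steps alpha A, (1 <= batch A)%N
    & output A = avg_output (stepsize A)]].

Variables (d : measure_display) (S : measurableType d).
Variables (Gf : 'rV[R]_n -> S -> 'rV[R]_n) (Gp : R -> 'rV[R]_n -> S -> 'rV[R]_n).
Variables (f p : 'rV[R]_n -> R) (gamma : R -> R).

Definition minibatch_grad (l : R) (B : nat) (s : nat -> S) (x : 'rV[R]_n) :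
    'rV[R]_n :=
  (B%:R)^-1 *: \sum_(i < B) (Gf x (s i) + gamma l *: Gp l x (s i)).

Variable X : set 'rV[R]_n.

Fixpoint sgd_path (l : R) (A : scheme) (x0 : 'rV[R]_n) (s : nat -> nat -> S)
    (t : nat) : 'rV[R]_n :=
  if t is t'.+1 then
    let x := sgd_path l A x0 s t' in
    proj X (x - stepsize A t' *: minibatch_grad l (batch A) (s t') x)
  else x0.

Variables (d' : measure_display) (Omega : measurableType d').

(* Samples are indexed by pairs (iteration t, position i in the mini-batch). *)
Definition sgd_output (l : R) (A : scheme) (x0 : 'rV[R]_n)
    (xi : nat * nat -> Omega -> S) (T : nat) (w : Omega) : 'rV[R]_n :=
  output A (sgd_path l A x0 (fun t i => xi (t, i) w)) T.

Definition success (xi : nat * nat -> Omega -> S) (xstar : 'rV[R]_n)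
    (l eps : R) (A : scheme) (x0 : 'rV[R]_n) (T : nat) : set Omega :=
  [set w | objective f p gamma l (sgd_output l A x0 xi T w) <=
           (1 + eps) * objective f p gamma l xstar].

Definition sampling_complexity (P : probability Omega R)
    (xi : nat * nat -> Omega -> S) (xstar : 'rV[R]_n) (l eps kappa : R)
    (A : scheme) (x0 : 'rV[R]_n) : \bar R :=
  ereal_inf [set ((T * batch A)%:R)%:E | T in [set T : nat |
    ((1 - kappa)%:E <=
      P (success xi xstar l eps A x0 T))%E]].

Definition efficient (P : R -> probability Omega R)
    (xi : R -> nat * nat -> Omega -> S) (xstar : R -> 'rV[R]_n)
    (A : R -> scheme) (x0 : R -> 'rV[R]_n) : Prop :=
  forall eps kappa : R, 0 < eps -> 0 < kappa < 1 ->
    (limsup_log_rate (fun l =>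
       sampling_complexity (P l) (xi l) (xstar l) l eps kappa (A l) (x0 l))
     <= 0)%E.

End SGD.

(* Main.v *)
(* After discarding the asymptotics the theorem is a statement about one rarity
   level at a time.  Safe start makes F(x_0) subexponential, the sublevel set
   {F <= F(x_0) + 1} has subexponential diameter because the convex f grows at
   least linearly, and on it the relative bounds on p turn into subexponential
   bounds K on the gradient, the local smoothness and the gradient variance of F
   (along a short step p at most doubles, so smoothness holds along the step).
   With steps of size K^-2 t^-alpha, K^m iterations and a batch size polynomial
   in K, all batch errors on the sublevel set are at most 1/(T K^2) with
   probability at least 1 - 1/K; on that event SGD is a slightly perturbed
   gradient descent, which does not leave the sublevel set and whose last and
   averaged iterates are 3/K-optimal.  This additive accuracy suffices because
   the minimal value of F is nondecreasing in gamma, hence bounded away from 0. *)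
Require Import Defs.
From HB Require Import structures.
From mathcomp Require Import all_boot all_order all_algebra finmap.
From mathcomp Require Import all_classical all_reals all_analysis.
From mathcomp Require Import ring lra measurable_realfun.

Set Implicit Arguments.
Unset Strict Implicit.
Unset Printing Implicit Defensive.

Import Order.TTheory GRing.Theory Num.Theory.
Import numFieldNormedType.Exports.

Local Open Scope classical_set_scope.
Local Open Scope ring_scope.

(** * Euclidean geometry of row vectors and derivatives along lines *)

Section Dot.
Variables (R : realType) (n : nat).
Implicit Types u v w : 'rV[R]_n.

(** The schemes are fixed before [eps] and [kappa], and only the decay exponent of the steps is
    prescribed. Noise is therefore suppressed by the batch size rather than by the steps, and since
    only exponential rates count, any power of [K] is affordable. [K] is made at least [l], so that
    [3 / K] and [1 / K] eventually fall below every prescribed accuracy and failure probability.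
    [gamma] may grow exponentially, but it only ever multiplies [p] or its derivatives, and
    [gamma l * p x <= F x]. The obstacle is a circularity: gradient, smoothness and variance are
    controlled only on the sublevel set, while the iterates stay there only if the earlier batch
    errors were small. Hence the second moments are truncated to the sublevel set, each bad event
    includes that its iterate lies there, and the deterministic analysis asks for a small error only
    while the iterate is inside. Conditioning on the past is replaced by product identities: the
    current iterate together with the partial batch sum is independent of all later samples, so
    Tonelli integrates out the next sample with the state frozen. *)

Definition dot u v : R := \sum_(i < n) u 0 i * v 0 i.

Lemma dotC u v : dot u v = dot v u.
Proof. by apply: eq_bigr => i _; rewrite mulrC. Qed.

Lemma dotDl u v w : dot (u + v) w = dot u w + dot v w.
Proof. by rewrite -big_split; apply: eq_bigr => i _; rewrite mxE mulrDl. Qed.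

Lemma dotZl a u w : dot (a *: u) w = a * dot u w.
Proof. by rewrite mulr_sumr; apply: eq_bigr => i _; rewrite mxE mulrA. Qed.

Lemma dotNl u w : dot (- u) w = - dot u w.
Proof. by rewrite -scaleN1r dotZl mulN1r. Qed.

Lemma dotBl u v w : dot (u - v) w = dot u w - dot v w.
Proof. by rewrite dotDl dotNl. Qed.

Lemma dotDr u v w : dot w (u + v) = dot w u + dot w v.
Proof. by rewrite dotC dotDl !(dotC w). Qed.

Lemma dotZr a u w : dot w (a *: u) = a * dot w u.
Proof. by rewrite dotC dotZl (dotC w). Qed.

Lemma dotBr u v w : dot w (u - v) = dot w u - dot w v.
Proof. by rewrite dotC dotBl !(dotC w). Qed.

Lemma dot0l w : dot 0 w = 0.
Proof. by rewrite -(scale0r 0) dotZl mul0r. Qed.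

Lemma dot_suml I (r : seq I) (F : I -> 'rV[R]_n) w :
  dot (\sum_(i <- r) F i) w = \sum_(i <- r) dot (F i) w.
Proof.
elim: r => [|i r IH]; first by rewrite !big_nil dot0l.
by rewrite !big_cons dotDl IH.
Qed.

Lemma dotuu_ge0 u : 0 <= dot u u.
Proof. by apply: sumr_ge0 => i _; rewrite -expr2 sqr_ge0. Qed.

Lemma enorm_sqr u : enorm u ^+ 2 = dot u u.
Proof.
rewrite /enorm sqr_sqrtr; first by apply: eq_bigr => i _; rewrite expr2.
by apply: sumr_ge0 => i _; rewrite sqr_ge0.
Qed.

Lemma enorm_ge0 u : 0 <= enorm u.
Proof. exact: sqrtr_ge0. Qed.

Lemma enorm_eq0 u : enorm u = 0 -> u = 0.
Proof.
move=> u0; apply/rowP => i; rewrite mxE.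
have /eqP : dot u u = 0 by rewrite -enorm_sqr u0 expr0n.
rewrite psumr_eq0 => [|j _]; last by rewrite -expr2 sqr_ge0.
by move=> /allP/(_ i (mem_index_enum _)) /=; rewrite mulf_eq0 orbb => /eqP.
Qed.

Lemma enorm_gt0 u : u != 0 -> 0 < enorm u.
Proof.
move=> u0; rewrite lt_neqAle enorm_ge0 andbT eq_sym.
by apply: contra_neq u0 => /enorm_eq0.
Qed.

Lemma enormZ a u : enorm (a *: u) = `|a| * enorm u.
Proof.
apply/eqP; rewrite -(eqrXn2 (n := 2)) ?mulr_ge0 ?enorm_ge0//.
by rewrite exprMn !enorm_sqr dotZl dotZr real_normK ?num_real// mulrA.
Qed.

Lemma enorm0 : enorm (0 : 'rV[R]_n) = 0.
Proof. by rewrite -(scale0r 0) enormZ normr0 mul0r. Qed.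

Lemma enormN u : enorm (- u) = enorm u.
Proof. by rewrite -scaleN1r enormZ normrN1 mul1r. Qed.

(** Cauchy-Schwarz, by expanding the squared norm of [enorm v *: u - enorm u *: v], which is
    [2 * (enorm u * enorm v)] times the difference of the two sides. *)
Lemma dot_le u v : dot u v <= enorm u * enorm v.
Proof.
have [->|u0] := eqVneq u 0; first by rewrite dot0l enorm0 mul0r.
have [->|v0] := eqVneq v 0; first by rewrite dotC dot0l enorm0 mulr0.
have up := enorm_gt0 u0.
have vp := enorm_gt0 v0.
have := dotuu_ge0 (enorm v *: u - enorm u *: v).
rewrite dotBl !dotBr !dotZl !dotZr -!enorm_sqr (dotC v u) => H.
have : 0 <= 2 * (enorm u * enorm v) * (enorm u * enorm v - dot u v) by lra.
by rewrite pmulr_rge0 ?subr_ge0// !mulr_gt0.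
Qed.

Lemma enormD_sqr u v :
  enorm (u + v) ^+ 2 = enorm u ^+ 2 + 2 * dot u v + enorm v ^+ 2.
Proof. by rewrite !enorm_sqr dotDl !dotDr (dotC v u); ring. Qed.

Lemma enormB_sqr u v :
  enorm (u - v) ^+ 2 = enorm u ^+ 2 - 2 * dot v u + enorm v ^+ 2.
Proof. by rewrite !enorm_sqr dotBl !dotBr (dotC u v); ring. Qed.

Lemma enormD u v : enorm (u + v) <= enorm u + enorm v.
Proof.
rewrite -(@ler_pXn2r _ 2) ?nnegrE ?addr_ge0 ?enorm_ge0//.
by rewrite enormD_sqr; have := dot_le u v; nra.
Qed.

Lemma enormB u v : enorm (u - v) <= enorm u + enorm v.
Proof. by rewrite -(enormN v) enormD. Qed.

Lemma enormDsqr_le u v :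
  enorm (u + v) ^+ 2 <= 2 * enorm u ^+ 2 + 2 * enorm v ^+ 2.
Proof.
have := dotuu_ge0 (u - v).
rewrite !enorm_sqr !dotDl !dotDr !dotNl !(dotC _ (- v)) !dotNl (dotC v u); lra.
Qed.

Lemma coord_le_enorm u i : `|u 0 i| <= enorm u.
Proof.
rewrite -(@ler_pXn2r _ 2) ?nnegrE ?enorm_ge0// real_normK ?num_real//.
rewrite enorm_sqr /dot (bigD1 i)//= -expr2 lerDl.
by apply: sumr_ge0 => j _; rewrite -expr2 sqr_ge0.
Qed.

(** [specnorm] is a [sup], so an upper bound for the set must be exhibited before any element can be
    compared with it; the sum of the row norms provides one. *)
Lemma enorm_mulmx_le (A : 'M[R]_n) v : enorm (v *m A) <= specnorm A * enorm v.
Proof.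
have bnd w : enorm (w *m A) <= (\sum_(i < n) enorm (row i A)) * enorm w.
  rewrite mulmx_sum_row mulr_suml.
  elim/big_ind2: _ => [|a b c d ab cd|i _]; first by rewrite enorm0.
    by rewrite (le_trans (enormD _ _))// lerD.
  by rewrite enormZ mulrC ler_wpM2l ?enorm_ge0 ?coord_le_enorm.
have [->|v0] := eqVneq v 0; first by rewrite mul0mx !enorm0 mulr0.
have vp := enorm_gt0 v0.
have -> : enorm (v *m A) = enorm ((enorm v)^-1 *: v *m A) * enorm v.
  by rewrite -scalemxAl enormZ normfV ger0_norm ?enorm_ge0// mulrAC mulVf ?mul1r ?gt_eqF.
rewrite ler_wpM2r ?enorm_ge0//; apply: ub_le_sup.
  exists (\sum_(i < n) enorm (row i A)) => _ [w /= w1 <-].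
  apply: (le_trans (bnd w)); apply: ler_piMr => //.
  by apply: sumr_ge0 => i _; exact: enorm_ge0.
exists ((enorm v)^-1 *: v) => //=.
by rewrite enormZ normfV ger0_norm ?enorm_ge0// mulVf ?gt_eqF.
Qed.

Lemma proj_setT y : Defs.proj [set: 'rV[R]_n] y = y.
Proof.
apply: xget_unique => [|z [_ /(_ y Logic.I)]].
  by split=> // w _; rewrite subrr enorm0 enorm_ge0.
rewrite subrr enorm0 => z0; apply/esym/eqP; rewrite -subr_eq0; apply/eqP.
by apply: enorm_eq0; apply/eqP; rewrite eq_le z0 enorm_ge0.
Qed.

(** Calculus is done along lines only: the difference quotient of the restriction at [s] is that of
    [f] at [x + s *: v] in direction [v], which brings everything under the one-variable mean value
    theorem. *)
Lemma line_is_derive (W : normedModType R) (f : 'rV[R]_n -> W) x v s :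
  derivable f (x + s *: v) v ->
  is_derive s 1 (fun r : R => f (x + r *: v)) ('D_v f (x + s *: v)).
Proof.
have E : (fun h : R => h^-1 *: ((f (x + (h *: 1 + s) *: v)) - f (x + s *: v))) =
  (fun h : R => h^-1 *: ((f \o shift (x + s *: v)) (h *: v) - f (x + s *: v))).
  apply/funext => h /=; congr (_ *: (f _ - _)).
  by rewrite scalerDl /= addrCA -[h%:A]/(h * 1) mulr1.
move=> df; apply: DeriveDef; first by rewrite /derivable /= E.
by rewrite /derive /= E.
Qed.

Lemma derive_grad (f : 'rV[R]_n -> R) x v :
  differentiable f x -> 'D_v f x = dot (grad f x) v.
Proof.
move=> df; rewrite deriveE// [in LHS](row_sum_delta v) linear_sum.
by apply: eq_bigr => i _; rewrite linearZ /= mxE deriveE// mulrC.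
Qed.

Lemma line_is_derive_grad (f : 'rV[R]_n -> R) x v s :
  differentiable f (x + s *: v) ->
  is_derive s 1 (fun r : R => f (x + r *: v)) (dot (grad f (x + s *: v)) v).
Proof.
by move=> df; rewrite -derive_grad//; apply/line_is_derive/diff_derivable.
Qed.

Lemma line_is_derive_hess (f : 'rV[R]_n -> R) x v w s :
  differentiable (grad f) (x + s *: v) ->
  is_derive s 1 (fun r : R => dot (grad f (x + r *: v)) w)
    (dot (v *m hess f (x + s *: v)) w).
Proof.
move=> df; rewrite -deriveEjacobian//.
have dg' : derivable (grad f) (x + s *: v) v by exact: diff_derivable.
have /derivable_mxP dg := dg'.
have -> : (fun r : R => dot (grad f (x + r *: v)) w) =
  (\sum_(i < n) (fun r : R => w 0 i *: grad f (x + r *: v) 0 i)).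
  by apply/funext => r; rewrite fct_sumE; apply: eq_bigr => i _; rewrite mulrC.
have -> : dot ('D_v (grad f) (x + s *: v)) w = \sum_(i < n)
   (w 0 i *: 'D_v (fun y => grad f y 0 i) (x + s *: v)).
  apply: eq_bigr => i _.
  by rewrite derive_mx// mxE mulrC.
apply: is_derive_sum => i.
by apply: is_deriveZ; apply: line_is_derive.
Qed.

End Dot.

(** * First and second order bounds along a segment *)

Section SegmentBounds.
Variables (R : realType) (n : nat).
Implicit Types (f p : 'rV[R]_n -> R) (x y v : 'rV[R]_n).

(** The closed interval admits [s = 0], which matters when the endpoint is itself an intermediate
    point of another mean value theorem. *)
Lemma MVT_from0 (phi dphi : R -> R) s : 0 <= s ->
  (forall r, is_derive r (1 : R) phi (dphi r)) ->
  exists2 c, 0 <= c <= s & phi s - phi 0 = dphi c * s.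
Proof.
move=> s0 dp.
have [c cI E] := MVT_segment s0 (fun r _ => dp r)
  (derivable_within_continuous (fun r _ => @ex_derive _ _ _ _ _ _ _ (dp r))).
by exists c; [move: cI; rewrite in_itv | rewrite E subr0].
Qed.

Lemma convex_functionE f x y t : convex_function [set: 'rV[R]_n] f ->
  0 <= t <= 1 -> f (x + t *: (y - x)) <= f x + t * (f y - f x).
Proof.
move=> cf /andP[t0 t1].
have := cf (Itv01 t0 t1) (y : convex_lmodType _) x; rewrite !in_setT => /(_ isT isT).
rewrite convRE /= /conv /= => H.
have -> : x + t *: (y - x) = t *: y + (1 - t) *: x.
  by rewrite scalerBl scale1r scalerBr addrCA.
by apply: (le_trans H); rewrite -[unstable.onem t]/(1 - t); lra.
Qed.

(** Convexity bounds each difference quotient with step in []0, 1]] by [f y - f x], and the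
    derivative is their limit from the right. *)
Lemma convex_grad_le f x y : convex_function [set: 'rV[R]_n] f ->
  differentiable f x -> f x + dot (grad f x) (y - x) <= f y.
Proof.
move=> cf df; rewrite -derive_grad// -lerBrDl.
have dv : derivable f x (y - x) by exact: diff_derivable.
apply: (cvgr_to_le (cvg_dnbhs_at_right dv)).
near=> h.
have h0 : 0 < h by near: h; exact: nbhs_right_gt.
have h1 : h <= 1 by near: h; exact: nbhs_right_le.
rewrite /= -[_^-1 *: _]/(_^-1 * _) ler_pdivrMl// lerBlDl [h *: _ + x]addrC.
by apply: convex_functionE; rewrite // h1 ltW.
Unshelve. all: end_near. Qed.

(* In place of Gronwall: at the maximum of [p] on the segment the increment over
   [p x] is at most half of the maximum. *)
Lemma segment_growth p x v :
  (forall y, differentiable p y) ->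
  (forall s, 0 <= s <= 1 ->
     dot (grad p (x + s *: v)) v <= p (x + s *: v) / 2) ->
  (forall y, 0 <= p y) ->
  forall s, 0 <= s <= 1 -> p (x + s *: v) <= 2 * p x.
Proof.
move=> dp bp p0.
pose phi (s : R) := p (x + s *: v).
have dphi s : is_derive s (1 : R) phi (dot (grad p (x + s *: v)) v).
  exact: line_is_derive_grad.
have [c] := EVT_max (@ler01 R)
  (derivable_within_continuous (fun r _ => @ex_derive _ _ _ _ _ _ _ (dphi r))).
rewrite in_itv /= => /andP[c0 c1] cmax.
suff pc : phi c <= 2 * phi 0.
  move=> s s01; have -> : p x = phi 0 by rewrite /phi scale0r addr0.
  by apply: le_trans pc; apply: cmax; rewrite in_itv.
have [e /andP[e0 ec] E] := MVT_from0 c0 dphi.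
have e1 : e <= 1 by exact: le_trans ec c1.
have := bp e; rewrite e0 e1 => /(_ isT) be.
have pe : phi e <= phi c by apply: cmax; rewrite in_itv /= e0 e1.
have pe0 : 0 <= phi e by exact: p0.
have : dot (grad p (x + e *: v)) v * c <= phi e / 2.
  rewrite (le_trans (ler_wpM2r c0 be))// -/(phi e).
  by apply: ler_piMr => //; rewrite divr_ge0.
by rewrite -E; lra.
Qed.

(** Two nested mean value theorems. The second one is applied on [[0, c]] and leaves a factor
    [c <= 1], hence [C] instead of the sharp [C / 2]. *)
Lemma segment_taylor f x v C : twice_cont_diff f ->
  (forall s, 0 <= s <= 1 -> dot (v *m hess f (x + s *: v)) v <= C) ->
  0 <= C ->
  f (x + v) <= f x + dot (grad f x) v + C.
Proof.
move=> [df dg _] bC C0.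
have [c /andP[c0 c1] E] := MVT_from0 (@ler01 R)
  (fun s => line_is_derive_grad (v := v) (df (x + s *: v))).
move: E; rewrite scale1r scale0r addr0 mulr1 => /eqP.
rewrite subr_eq => /eqP ->.
have [e /andP[e0 ec]] := MVT_from0 c0
  (fun s => line_is_derive_hess (v := v) v (dg (x + s *: v))).
rewrite scale0r addr0 => /eqP; rewrite subr_eq => /eqP ->.
have := bC e; rewrite e0 (le_trans ec c1) => /(_ isT) be.
have : dot (v *m hess f (x + e *: v)) v * c <= C.
  by rewrite (le_trans (ler_wpM2r c0 be))// ler_piMr.
lra.
Qed.

(** A vector-valued map has no mean value equality, so the gradient is tested against its own
    increment [w]; this yields [enorm w ^+ 2] on the left, and one factor cancels. *)
Lemma grad_lipschitz_at f x0 x L : 0 <= L -> twice_cont_diff f ->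
  (forall y, specnorm (hess f y) <= L) ->
  enorm (grad f x) <= enorm (grad f x0) + L * enorm (x - x0).
Proof.
move=> L0 [df dg _] bL.
set w := grad f x - grad f x0; set v := x - x0.
have [c _] := MVT_from0 (@ler01 R)
  (fun s => line_is_derive_hess (x := x0) (v := v) w (dg (x0 + s *: v))).
rewrite scale1r scale0r addr0 mulr1 (addrC x0) subrK -dotBl -/w -enorm_sqr => E.
suff wL : enorm w <= L * enorm v.
  rewrite -[X in enorm X <= _](subrK (grad f x0)) -/w addrC.
  by rewrite (le_trans (enormD _ _))// lerD2l.
have [->|w0] := eqVneq (enorm w) 0.
  by rewrite mulr_ge0 ?enorm_ge0.
rewrite -(ler_pM2r (x := enorm w)) ?lt_neqAle ?enorm_ge0 ?andbT 1?eq_sym//.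
rewrite -expr2 E (le_trans (dot_le _ _))// ler_wpM2r ?enorm_ge0//.
by rewrite (le_trans (enorm_mulmx_le _ _))// ler_wpM2r ?enorm_ge0.
Qed.

End SegmentBounds.

(** * Deterministic gradient descent with small errors *)

Section InexactGradientDescent.
Variables (R : realType) (n : nat) (F : 'rV[R]_n -> R) (g : 'rV[R]_n -> 'rV[R]_n).
Variables (xs : 'rV[R]_n) (M r L G D delta eta0 : R).
Hypothesis g_subgrad : forall a b, F a + dot (g a) (b - a) <= F b.
Hypothesis descent : forall a v, F a <= M -> enorm v <= r ->
  F (a + v) <= F a + dot (g a) v + L * enorm v ^+ 2.
Hypothesis g_bounded : forall a, F a <= M -> enorm (g a) <= G.
Hypothesis sublevel_dist : forall a, F a <= M -> enorm (a - xs) <= D.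
Hypothesis delta_ge0 : 0 <= delta.
Hypothesis D_ge0 : 0 <= D.
Hypothesis eta0_r : eta0 * (G + delta) <= r.
Hypothesis eta0_L : eta0 * (2 * L) <= 1.

Section Step.
Variables (eta : R) (a e : 'rV[R]_n).
Hypothesis L_ge0 : 0 <= L.
Hypothesis eta_gt0 : 0 < eta.
Hypothesis eta_le : eta <= eta0.
Hypothesis Fa : F a <= M.
Hypothesis e_small : enorm e <= delta.
Let v := - (eta *: (g a + e)).

Let etaL : eta * (2 * L) <= 1.
Proof.
by apply: le_trans eta0_L; rewrite ler_wpM2r// mulr_ge0.
Qed.

Let step_descent : F (a + v) <= F a + dot (g a) v + L * enorm v ^+ 2.
Proof.
apply: descent => //; apply: le_trans eta0_r.
rewrite enormN enormZ ger0_norm ?(ltW eta_gt0)// ler_pM ?enorm_ge0 ?(ltW eta_gt0)//.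
by rewrite (le_trans (enormD _ _))// lerD// g_bounded.
Qed.

Let Lv_le : 2 * eta * (L * enorm v ^+ 2) <= enorm v ^+ 2.
Proof.
rewrite mulrA -[X in _ <= X]mul1r ler_wpM2r ?sqr_ge0//.
by apply: le_trans etaL; rewrite -mulrA mulrCA.
Qed.

Let e_sqr : enorm e ^+ 2 <= delta ^+ 2.
Proof. by rewrite lerXn2r ?nnegrE ?enorm_ge0. Qed.

(** The terms in [dot (g a) e] from the linear and the quadratic part cancel, leaving
    [eta / 2 * (dot e e - dot (g a) (g a))]. The loss is thus quadratic in [delta] and free of the
    gradient bound. *)
Lemma step_almost_descent : F (a + v) <= F a + eta0 * delta ^+ 2.
Proof.
have vE : enorm v ^+ 2 = eta * (eta * (dot (g a) (g a) + 2 * dot (g a) e + dot e e)).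
  rewrite enorm_sqr /v -scaleN1r !(dotZl, dotZr) !dotDl !dotDr (dotC e); ring.
have vg : dot (g a) v = - eta * (dot (g a) (g a) + dot (g a) e).
  by rewrite /v -scaleNr dotZr dotDr.
have H : 2 * (L * enorm v ^+ 2) <=
   eta * (dot (g a) (g a) + 2 * dot (g a) e + dot e e).
  rewrite -(ler_pM2l eta_gt0).
  have -> : eta * (2 * (L * enorm v ^+ 2)) = 2 * eta * (L * enorm v ^+ 2) by ring.
  by have := Lv_le; rewrite [leRHS]vE.
have ge0 := dotuu_ge0 (g a).
have ee : eta * dot e e <= eta0 * delta ^+ 2.
  by rewrite ler_pM ?(ltW eta_gt0) ?dotuu_ge0// -enorm_sqr.
have ee0 : 0 <= eta * dot e e by rewrite mulr_ge0 ?dotuu_ge0 ?(ltW eta_gt0).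
have eg0 : 0 <= eta * dot (g a) (g a) by rewrite mulr_ge0 ?(ltW eta_gt0).
have := step_descent; rewrite vg; nra.
Qed.

(** The square of [a - xs = b - v] is expanded; the term [enorm v ^+ 2] it produces pays for the
    smoothness term because [eta * (2 * L) <= 1]. The value is taken at the new point, which is why
    [eta t] is paired with [x t.+1] in the averaged output. *)
Lemma step_progress : F (a + v) <= M ->
  2 * (eta * (F (a + v) - F xs)) <=
  enorm (a - xs) ^+ 2 - enorm (a + v - xs) ^+ 2 + 2 * eta * (delta * D).
Proof.
move=> FM; set b := a + v - xs.
have -> : a - xs = b - v by rewrite /b addrAC addrK.
have bD : enorm b <= D by exact: sublevel_dist.
have gv : eta * dot (g a) b = - dot v b - eta * dot e b.
  rewrite /v dotNl dotZl dotDl; ring.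
have eb : - dot e b <= delta * D.
  rewrite -dotNl (le_trans (dot_le _ _))// enormN ler_pM ?enorm_ge0//.
have {}eb : eta * - dot e b <= eta * (delta * D) by rewrite ler_wpM2l ?(ltW eta_gt0).
have H1 := step_descent; have H2 := g_subgrad a xs.
have : F (a + v) - F xs <= dot (g a) b + L * enorm v ^+ 2.
  have -> : b = v - (xs - a) by rewrite /b opprB addrCA addrA.
  by rewrite dotBr; lra.
move=> /(ler_wpM2l (ltW eta_gt0)) H3.
have := Lv_le.
rewrite enormB_sqr.
lra.
Qed.

End Step.

Variables (eta : nat -> R) (x e : nat -> 'rV[R]_n) (T : nat).
Hypothesis L_ge0 : 0 <= L.
Hypothesis eta_gt0 : forall t, 0 < eta t.
Hypothesis eta_le : forall t, eta t <= eta0.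
Hypothesis xS : forall t, x t.+1 = x t - eta t *: (g (x t) + e t).
Hypothesis e_small : forall t, (t < T)%N -> F (x t) <= M -> enorm (e t) <= delta.
Hypothesis M_large : F (x 0) + T%:R * (eta0 * delta ^+ 2) <= M.

Let ed_ge0 : 0 <= eta0 * delta ^+ 2.
Proof. by rewrite mulr_ge0 ?sqr_ge0// (le_trans _ (eta_le 0))// ltW. Qed.

(** Staying below [M] and almost decreasing are proved together, since each step requires its
    starting point in the sublevel set. The free start [s] serves to compare the last iterate with
    every earlier one. *)
Lemma iterates_almost_descent s t : (s + t <= T)%N ->
  F (x s) <= F (x 0) + s%:R * (eta0 * delta ^+ 2) ->
  F (x (s + t)) <= F (x s) + t%:R * (eta0 * delta ^+ 2).
Proof.
move=> stT Fs; elim: t stT => [|t IH] stT.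
  by rewrite addn0 mul0r addr0.
have {}IH := IH (ltnW (leq_trans (eq_leq (esym (addnS s t))) stT)).
have FM : F (x (s + t)) <= M.
  apply: le_trans M_large; apply: (le_trans IH); apply: (le_trans (lerD Fs (lexx _))).
  rewrite -addrA -mulrDl lerD2l ler_wpM2r// -natrD ler_nat.
  by rewrite (leq_trans _ stT)// addnS.
rewrite addnS xS (le_trans (step_almost_descent L_ge0 (eta_gt0 _) (eta_le _) FM _))//.
  by rewrite e_small// -addnS.
by rewrite -natr1 mulrDl mul1r addrA lerD2r.
Qed.

Lemma iterates_descent_from0 t : (t <= T)%N ->
  F (x t) <= F (x 0) + t%:R * (eta0 * delta ^+ 2).
Proof.
by move=> tT; apply: (@iterates_almost_descent 0 t); rewrite ?add0n// mul0r addr0.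
Qed.

Lemma iterates_sublevel t : (t <= T)%N -> F (x t) <= M.
Proof.
move=> tT; apply: le_trans M_large; apply: (le_trans (iterates_descent_from0 tT)).
by rewrite lerD2l ler_wpM2r// ler_nat.
Qed.

Lemma iterates_regret :
  \sum_(t < T) eta t * (F (x t.+1) - F xs) <=
  D ^+ 2 + (\sum_(t < T) eta t) * (delta * D).
Proof.
suff H t : (t <= T)%N -> 2 * (\sum_(i < t) eta i * (F (x i.+1) - F xs)) <=
    enorm (x 0 - xs) ^+ 2 - enorm (x t - xs) ^+ 2 +
    2 * (\sum_(i < t) eta i) * (delta * D).
  have := H _ (leqnn T); have := sqr_ge0 (enorm (x T - xs)).
  have : enorm (x 0 - xs) ^+ 2 <= D ^+ 2.
    by rewrite lerXn2r ?nnegrE ?enorm_ge0// sublevel_dist// iterates_sublevel.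
  by have := sqr_ge0 D; lra.
elim: t => [|t IH] tT; first by rewrite !big_ord0 !(mulr0, mul0r) addr0 subrr.
rewrite !big_ord_recr/= !mulrDr mulrDl.
have FM := iterates_sublevel (ltnW tT).
have := @step_progress (eta t) (x t) (e t) L_ge0 (eta_gt0 t) (eta_le t) FM
  (e_small tT FM).
rewrite -xS => /(_ (iterates_sublevel tT)).
have := IH (ltnW tT); lra.
Qed.

Let W := \sum_(t < T) eta t.
Hypothesis T_gt0 : (0 < T)%N.

Let W_gt0 : 0 < W.
Proof.
by rewrite /W -(prednK T_gt0) big_ord_recl ltr_wpDr// sumr_ge0// => i _; exact/ltW.
Qed.

(** Common end of both output rules: it suffices that the weighted gap of [z] is dominated by the
    regret sum. *)
Let gap_le z : W * (z - F xs) <= \sum_(t < T) eta t * (F (x t.+1) - F xs) ->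
  z <= F xs + (D ^+ 2 / \sum_(t < T) eta t + delta * D).
Proof.
move=> H; rewrite -lerBlDl -(ler_pM2l W_gt0) (le_trans H)//.
apply: (le_trans iterates_regret).
by rewrite -/W mulrDr [W * (_ / _)]mulrC divfK ?gt_eqF.
Qed.

(** By almost descent the last value exceeds every earlier one by at most the total drift, so minus
    this drift it lies below their weighted mean. *)
Lemma last_gap : F (x T) <=
  F xs + (D ^+ 2 / \sum_(t < T) eta t + delta * D) + T%:R * (eta0 * delta ^+ 2).
Proof.
rewrite -lerBlDr; apply: gap_le.
rewrite mulr_suml; apply: ler_sum => t _; rewrite ler_wpM2l ?(ltW (eta_gt0 _))//.
rewrite lerD2r lerBlDr.
have tT := ltn_ord t.
have := @iterates_almost_descent t.+1 (T - t.+1); rewrite subnKC//.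
move=> /(_ (leqnn T) (iterates_descent_from0 tT)) H; apply: (le_trans H).
by rewrite lerD2l ler_wpM2r// ler_nat leq_subr.
Qed.

(** Jensen's inequality through the subgradient at the average [xb]: the linear terms add up to zero
    because the weighted deviations from [xb] do. *)
Lemma avg_gap : F (avg_output eta x T) <=
  F xs + (D ^+ 2 / \sum_(t < T) eta t + delta * D).
Proof.
apply: gap_le; rewrite /avg_output gtn_eqF// -/W.
set xb := _ *: _.
have key : \sum_(t < T) eta t *: (x t.+1 - xb) = 0.
  under eq_bigr do rewrite scalerBr.
  rewrite sumrB -scaler_suml -/W /xb scalerA divff ?gt_eqF// scale1r.
  by rewrite subrr.
rewrite mulr_suml.
have -> : \sum_(i < T) eta i * (F xb - F xs) =
    \sum_(i < T) eta i * (F xb - F xs) + dot (\sum_(t < T) eta t *: (x t.+1 - xb)) (g xb).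
  by rewrite key dot0l addr0.
rewrite dot_suml -big_split; apply: ler_sum => t _ /=.
rewrite dotZl -mulrDr ler_wpM2l ?(ltW (eta_gt0 _))//.
have := g_subgrad xb (x t.+1); rewrite dotC; lra.
Qed.

End InexactGradientDescent.

(** * Borel measurability of vector-valued maps *)

Section BorelRowVectors.
Variables (R : realType) (n : nat).

Let Bor : measurableType _ := g_sigma_algebraType (@open 'rV[R]_n).

Lemma continuous_borel_measurable (h : 'rV[R]_n -> R) :
  continuous h -> measurable_fun [set: Bor] h.
Proof.
move=> ch; apply: (measurability _ (RGenOpens.measurableE R)) => /=.
move=> _ [_ [a [b ->]] <-]; apply: measurableI => //.
by apply: sub_sigma_algebra; apply: open_comp => [x _|]; [exact: ch|exact: itv_open].
Qed.

Lemma coord_borel_measurable i : measurable_fun [set: Bor] (fun x : Bor => x 0 i).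
Proof. by apply: continuous_borel_measurable; exact: coord_continuous. Qed.

Let box (q : 'rV[rat]_n) (k : nat) : set 'rV[R]_n :=
  [set x | forall i, `|ratr (q 0 i) - x 0 i| < k.+1%:R^-1].

(** Second countability in explicit form. The sigma-algebra is generated by all open sets, whereas
    measurable coordinates only control boxes, so open sets must be countable unions of boxes. *)
Lemma open_rational_boxes (U : set 'rV[R]_n) : open U ->
  U = \bigcup_(j : 'rV[rat]_n * nat)
        (if `[< box j.1 j.2 `<=` U >] then box j.1 j.2 else set0).
Proof.
move=> oU; apply/seteqP; split; last first.
  by move=> x [j _]; case: asboolP => // sub /sub.
move=> x Ux; have /nbhs_ballP[e /= e0 eU] := open_nbhs_nbhs (conj oU Ux).
(* Twice the radius must fit into [e]: the rational centre is within one radius of [x], and every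
   point of the box within one radius of the centre. *)
have [k ke] : exists k, k.+1%:R^-1 + k.+1%:R^-1 < e :> R.
  exists (Num.trunc (2 / e)); rewrite -mulr2n -[_ *+ 2]mulr_natl.
  rewrite ltr_pdivrMr ?ltr0n// mulrC -ltr_pdivrMr//.
  by have /andP[] := truncn_itv (divr_ge0 (ler0n R 2) (ltW e0)).
have H i : exists q : rat, `|ratr q - x 0 i| < k.+1%:R^-1.
  have k0 : 0 < k.+1%:R^-1 :> R by rewrite invr_gt0.
  have [|q] := @rat_in_itvoo R (x 0 i - k.+1%:R^-1) (x 0 i + k.+1%:R^-1).
    by rewrite ltrD2l (lt_trans _ k0)// oppr_lt0.
  by rewrite in_itv /= => /andP[q1 q2]; exists q; rewrite ltr_norml ltrBrDl q1 ltrBlDl q2.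
have [q Hq] := choice H.
have sub : box (\row_i q i) k `<=` U.
  move=> y Hy; apply: eU; split=> // a i; rewrite (ord1 a).
  rewrite /ball /= (le_lt_trans _ ke)//.
  have -> : x 0 i - y 0 i = (ratr (q i) - y 0 i) - (ratr (q i) - x 0 i) by ring.
  rewrite (le_trans (ler_normB _ _))// lerD ?(ltW (Hq i))//.
  by have := Hy i; rewrite mxE => /ltW.
exists (\row_i q i, k) => //=; case: asboolP => // _ i.
by rewrite mxE.
Qed.

Lemma rV_borel_measurable d (T : measurableType d) (h : T -> 'rV[R]_n) :
  (forall i, measurable_fun [set: T] (fun t => h t 0 i)) ->
  measurable_fun [set: T] (h : T -> Bor).
Proof.
move=> mh; apply: (@measurability _ _ T Bor setT h (@open _)) => //.
move=> _ [U oU <-]; apply: measurableI => //.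
rewrite (open_rational_boxes oU) preimage_bigcup.
apply: countable_bigcupT_measurable => // -[q k] /=.
case: asboolP => _; last by rewrite preimage_set0.
have -> : h @^-1` box q k =
   \bigcap_(i in [set: 'I_n])
     ((fun t => `|ratr (q 0 i) - h t 0 i|) @^-1` `]-oo, k.+1%:R^-1[).
  apply/seteqP; split=> t H i; first by move=> _; rewrite /= in_itv /=.
  by have := H i Logic.I; rewrite /= in_itv.
apply: fin_bigcap_measurable; first exact: finite_finset.
move=> i _; rewrite -[X in measurable X]setTI.
apply: (_ : measurable_fun [set: T] (fun t => `|ratr (q 0 i) - h t 0 i|)) => //.
by apply: measurableT_comp => //; apply: measurable_funB.
Qed.

Section Operations.
Context d (T : measurableType d).
Implicit Types u v : T -> 'rV[R]_n.

Lemma measurable_coord u i : measurable_fun [set: T] (u : T -> Bor) ->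
  measurable_fun [set: T] (fun t => u t 0 i).
Proof.
by move=> mu; apply: (measurableT_comp (coord_borel_measurable i) mu).
Qed.

Lemma measurable_rVD u v : measurable_fun [set: T] (u : T -> Bor) ->
  measurable_fun [set: T] (v : T -> Bor) ->
  measurable_fun [set: T] ((fun t => u t + v t) : T -> Bor).
Proof.
move=> mu mv; apply: rV_borel_measurable => i.
under eq_fun do rewrite mxE.
by apply: measurable_funD; apply: measurable_coord.
Qed.

Lemma measurable_rVZ (a : T -> R) u : measurable_fun [set: T] a ->
  measurable_fun [set: T] (u : T -> Bor) ->
  measurable_fun [set: T] ((fun t => a t *: u t) : T -> Bor).
Proof.
move=> ma mu; apply: rV_borel_measurable => i.
under eq_fun do rewrite mxE.
by apply: measurable_funM => //; apply: measurable_coord.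
Qed.

Lemma measurable_rVB u v : measurable_fun [set: T] (u : T -> Bor) ->
  measurable_fun [set: T] (v : T -> Bor) ->
  measurable_fun [set: T] ((fun t => u t - v t) : T -> Bor).
Proof.
move=> mu mv; apply: rV_borel_measurable => i.
under eq_fun do rewrite !mxE.
by apply: measurable_funB; apply: measurable_coord.
Qed.

Lemma measurable_rV_sum I (r : seq I) (u : I -> T -> 'rV[R]_n) :
  (forall i, measurable_fun [set: T] (u i : T -> Bor)) ->
  measurable_fun [set: T] ((fun t => \sum_(i <- r) u i t) : T -> Bor).
Proof.
move=> mu; apply: rV_borel_measurable => j.
under eq_fun do rewrite summxE.
by apply: measurable_sum => i; apply: measurable_coord.
Qed.

Lemma measurable_enorm_sqr u : measurable_fun [set: T] (u : T -> Bor) ->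
  measurable_fun [set: T] (fun t => enorm (u t) ^+ 2).
Proof.
move=> mu; under eq_fun do rewrite enorm_sqr.
by apply: measurable_sum => i; apply: measurable_funM; apply: measurable_coord.
Qed.

End Operations.

End BorelRowVectors.

(** * Independence of a state from the samples not yet used *)

Section Independence.
Context (R : realType) (d d' : measure_display) (Omega : measurableType d)
  (S : measurableType d').
Variables (P : probability Omega R) (mu : probability S R) (J : choiceType)
  (xi : J -> Omega -> S).
Hypothesis xi_iid : iid P mu xi.

Local Open Scope ereal_scope.

(** [Z] is independent of the i.i.d. family indexed by [L], expressed on finite rectangles with the
    factors [mu (A j)] already evaluated; this form passes through induction over the samples. *)
Definition indep_samples dE (E : measurableType dE) (Z : Omega -> E)
    (L : set J) : Prop :=
  measurable_fun [set: Omega] Z /\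
  forall (K : {fset J}) (A : J -> set S) (C : set E),
    (forall j, measurable (A j)) -> measurable C -> [set` K] `<=` L ->
    P (Z @^-1` C `&` \bigcap_(j in [set` K]) (xi j @^-1` A j)) =
    P (Z @^-1` C) * \prod_(j <- K) mu (A j).

Let bigcap_xi (K : {fset J}) (A : J -> set S) : (forall j, measurable (A j)) ->
  measurable (\bigcap_(j in [set` K]) (xi j @^-1` A j)).
Proof.
move=> mA; apply: fin_bigcap_measurable; first exact: finite_fset.
move=> j _; have [mxi _ _] := xi_iid.
by rewrite -[X in measurable X]setTI; apply: mxi.
Qed.

Lemma indep_samples_cst dE (E : measurableType dE) (z : E) (L : set J) :
  indep_samples (fun=> z) L.
Proof.
split=> [|K A C mA mC _]; first exact: measurable_cst.
have [mxi xi_mu xi_ind] := xi_iid.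
have prodE : P (\bigcap_(j in [set` K]) (xi j @^-1` A j)) = \prod_(j <- K) mu (A j).
  by rewrite xi_ind//; apply: eq_bigr => j _; rewrite xi_mu.
have [Cz|Cz] := pselect (C z).
- rewrite (_ : _ @^-1` C = setT); last by apply/seteqP; split.
  by rewrite setTI probability_setT mul1e.
- rewrite (_ : _ @^-1` C = set0); last by apply/seteqP; split.
  by rewrite set0I measure0 mul0e.
Qed.

Lemma indep_samples_comp dE (E : measurableType dE) dF (F : measurableType dF)
    (Z : Omega -> E) (phi : E -> F) (L L' : set J) :
  measurable_fun [set: E] phi -> L' `<=` L ->
  indep_samples Z L -> indep_samples (fun w => phi (Z w)) L'.
Proof.
move=> mphi LL [mZ iZ]; split; first exact: measurableT_comp.
move=> K A C mA mC KL.
have mC' : measurable (phi @^-1` C) by rewrite -[X in measurable X]setTI; exact: mphi.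
exact: (iZ K A _ mA mC' (subset_trans KL LL)).
Qed.

Section Step.
Context dE (E : measurableType dE) (Z : {mfun Omega >-> E}) (L : set J) (j : J).
Hypothesis Lj : L j.
Hypothesis Z_indep : indep_samples Z L.

Let W w := (Z w, xi j w).

Let mW : measurable_fun [set: Omega] W.
Proof. by apply: measurable_fun_pair => //; have [] := xi_iid. Qed.

HB.instance Definition _ := isMeasurableFun.Build _ _ _ _ W mW.

(** For a fixed event on the remaining samples, the restricted law of the pair and the scaled
    product measure agree on rectangles, hence everywhere by uniqueness of product measures.
    Carrying the event along is what makes the pair independent of the remaining samples again. *)
Let pair_law_on (K : {fset J}) (A : J -> set S) (X : set (E * S)) :
  (forall j, measurable (A j)) -> [set` K] `<=` L `\ j -> measurable X ->
  P (W @^-1` X `&` \bigcap_(j in [set` K]) (xi j @^-1` A j)) =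
  \prod_(j <- K) mu (A j) * (distribution P Z \x mu) X.
Proof.
move=> mA KL mX.
set EK := \bigcap_(j in _) _; set c := \prod_(j <- K) _.
have mEK : measurable EK by exact: bigcap_xi.
have [_ iZ] := Z_indep.
have KL' : [set` K] `<=` L by move=> k /KL [].
have PE : P EK = c.
  have := iZ K A setT mA measurableT KL'.
  by rewrite preimage_setT setTI probability_setT mul1e.
have c_fin : c \is a fin_num by rewrite -PE fin_num_measure.
have c_ge0 : (0 <= fine c)%R by rewrite -PE fine_ge0// measure_ge0.
pose m1 := mscale (NngNum c_ge0) (distribution P Z).
pose m' := pushforward (mrestr P mEK) W.
have rect C B : measurable C -> measurable B -> m' (C `*` B) = m1 C * mu B.
  move=> mC mB; rewrite /m' /m1 /pushforward /mrestr /mscale /= fineK//.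
  pose A' i := if i == j then B else A i.
  have jK : j \notin K by apply/negP => /KL[_]; exact.
  have AE : {in K, A' =1 A}.
    by move=> i iK; rewrite /A' ifF//; apply: contraNF jK => /eqP <-.
  have := iZ (j |` K)%fset A' C _ mC _; rewrite big_fsetU1//=.
  rewrite [A' j]/A' eqxx.
  have -> : \prod_(i <- K) mu (A' i) = c.
    by rewrite /c big_seq [RHS]big_seq; apply: eq_bigr => i iK; rewrite AE.
  rewrite (_ : Z @^-1` C `&` _ = W @^-1` (C `*` B) `&` EK).
    move=> ->; first by rewrite [mu B * c]muleC muleA [P _ * c]muleC.
    - by move=> i; rewrite /A'; case: ifP.
    - move=> i; rewrite /= !inE => /orP[/eqP ->//|]. exact: KL'.
  apply/seteqP; split=> w /=.
    move=> [ZC H]; split; last first.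
      move=> i iK; rewrite -(AE i iK); apply: H => /=.
      by rewrite !inE [i \in K]iK orbT.
    split=> //; have := H j; rewrite /= !inE eqxx /A' eqxx; exact.
  move=> [[ZC xB] H]; split=> // i; rewrite /= !inE /A'.
  by case: eqP => [->//|_ /= iK]; exact: H.
transitivity ((m1 \x mu) X); first exact/esym/(product_measure_unique rect mX).
rewrite /product_measure1 /m1 ge0_integral_mscale//=; first by rewrite fineK.
exact: measurable_fun_xsection.
Qed.

Lemma indep_samples_pair_law (X : set (E * S)) : measurable X ->
  P (W @^-1` X) = (distribution P Z \x mu) X.
Proof.
move=> mX; have := @pair_law_on fset0 (fun=> setT) X (fun=> measurableT) _ mX.
rewrite set_fset0 bigcap_set0 setIT big_seq_fset0 mul1e; apply.
exact: sub0set.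
Qed.

Lemma indep_samples_pair : indep_samples W (L `\ j).
Proof.
split=> // K A C mA mC KL.
by rewrite pair_law_on// indep_samples_pair_law// muleC.
Qed.

(** Substitute for the conditional expectation given [Z]: the fresh sample is integrated out while
    the state is held fixed. *)
Lemma indep_samples_integral (h : E * S -> \bar R) :
  measurable_fun [set: E * S] h -> (forall z, 0 <= h z) ->
  \int[P]_w h (Z w, xi j w) = \int[P]_w \int[mu]_s h (Z w, s).
Proof.
move=> mh h0.
rewrite -[LHS]/(\int[P]_w (h \o W) w).
rewrite -[RHS]/(\int[P]_w ((fun z => \int[mu]_s h (z, s)) \o Z) w).
rewrite -(@ge0_integral_distribution _ _ _ _ _ P W)//.
rewrite -(@ge0_integral_distribution _ _ _ _ _ P Z)//; last 2 first.
- exact: measurable_fun_fubini_tonelli_F.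
- by move=> z; exact: integral_ge0.
rewrite -[RHS]fubini_tonelli1//; apply: eq_measure_integral => X mX _ /=.
exact: indep_samples_pair_law.
Qed.

End Step.

End Independence.

(** * Second moment and tail of the mini-batch error *)

Section MinibatchNoise.
Context (R : realType) (n : nat) (d d' : measure_display)
  (Omega : measurableType d) (S : measurableType d').
Variables (P : probability Omega R) (mu : probability S R)
  (xi : nat * nat -> Omega -> S).
Hypothesis xi_iid : iid P mu xi.

Let Bor : measurableType _ := g_sigma_algebraType (@open 'rV[R]_n).

Variables (G : 'rV[R]_n -> S -> 'rV[R]_n) (g : 'rV[R]_n -> 'rV[R]_n).
Variables (Reg : set 'rV[R]_n) (V : R) (B : nat) (eta : nat -> R).
Variables (x : nat -> Omega -> 'rV[R]_n) (x0 : 'rV[R]_n).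
Hypothesis mG : jointly_measurable G.
Hypothesis mg : measurable_fun [set: Bor] (g : Bor -> Bor).
Hypothesis mReg : measurable (Reg : set Bor).
Hypothesis V_ge0 : 0 <= V.
Hypothesis B_gt0 : (0 < B)%N.
Hypothesis variance_le : forall y a, Reg y ->
  (\int[mu]_s (enorm (a + (G y s - g y)) ^+ 2)%:E <= (enorm a ^+ 2 + V)%:E)%E.

Let batch_sum t k w : 'rV[R]_n := \sum_(i < k) G (x t w) (xi (t, i : nat) w).

Hypothesis x_0 : forall w, x 0 w = x0.
Hypothesis x_S : forall t w,
  x t.+1 w = x t w - eta t *: (B%:R^-1 *: batch_sum t B w).

(** The state keeps the partial batch sum next to the iterate, so that samples can be consumed one
    at a time while [x t] stays frozen. *)
Let Z t k w : Bor * Bor := (x t w, batch_sum t k w).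

Let mGB dT (T : measurableType dT) (y : T -> 'rV[R]_n) (s : T -> S) :
  measurable_fun [set: T] (y : T -> Bor) -> measurable_fun [set: T] s ->
  measurable_fun [set: T] ((fun z => G (y z) (s z)) : T -> Bor).
Proof.
move=> my ms; apply: rV_borel_measurable => i.
exact: (measurableT_comp (mG i) (measurable_fun_pair my ms)).
Qed.

(** Indices from [(t, k)] on in lexicographic order: the samples that have not entered [Z t k]. *)
Let later t k : set (nat * nat) :=
  [set j | (t < j.1)%N \/ (j.1 = t /\ (k <= j.2)%N)].

Let mfun_of dT (T : measurableType dT) (f : Omega -> T)
  (mf : measurable_fun [set: Omega] f) : {mfun Omega >-> T} :=
  HB.pack f (isMeasurableFun.Build _ _ _ _ f mf).

Let indep_state_batch t : indep_samples P mu xi (Z t 0) (later t 0) ->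
  forall k, indep_samples P mu xi (Z t k) (later t k).
Proof.
move=> i0; elim=> [//|k IH].
have Lk : later t k (t, k) by right.
have := @indep_samples_pair _ _ _ _ _ P mu _ xi xi_iid _ _ (mfun_of IH.1) _ _ Lk IH.
pose phi (z : (Bor * Bor) * S) : Bor * Bor := (z.1.1, z.1.2 + G z.1.1 z.2).
have mphi : measurable_fun setT phi.
  apply: measurable_fun_pair; first exact: measurableT_comp.
  apply: measurable_rVD; first exact: measurableT_comp.
  by apply: mGB => //; exact: measurableT_comp.
move=> /(indep_samples_comp (L' := later t k.+1) mphi) H.
have -> : Z t k.+1 = (fun w => phi (Z t k w, xi (t, k) w)).
  by apply/funext => w; rewrite /Z /phi /batch_sum big_ord_recr.
apply: H => -[t' k'] /= H; split.
  by case: H => [H|[H1 H2]]; [left|right; split=> //; exact: ltnW].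
by move=> [tt kk]; case: H => [|[_]]; rewrite ?tt ?kk /= ltnn.
Qed.

Let indep_state t k : indep_samples P mu xi (Z t k) (later t k).
Proof.
elim: t k => [|t IH].
  apply: indep_state_batch.
  have -> : Z 0 0 = (fun=> (x0 : Bor, 0 : Bor)).
    by apply/funext => w; rewrite /Z /batch_sum big_ord0 x_0.
  exact: indep_samples_cst.
apply: indep_state_batch.
pose phi (z : Bor * Bor) : Bor * Bor := (z.1 - eta t *: (B%:R^-1 *: z.2), 0).
have mphi : measurable_fun setT phi.
  apply: measurable_fun_pair; last exact: measurable_cst.
  apply: measurable_rVB => //.
  by apply: measurable_rVZ => //; apply: measurable_rVZ.
have -> : Z t.+1 0 = (fun w => phi (Z t B w)).
  by apply/funext => w; rewrite /Z /phi /= /batch_sum big_ord0 x_S.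
apply: (indep_samples_comp mphi _ (IH B)).
by move=> [t' k'] [/= H|[/= -> _]]; left => //=; exact: ltnW.
Qed.

Lemma iterate_measurable t : measurable_fun [set: Omega] (x t : Omega -> Bor).
Proof.
have [mZ _] := indep_state t 0.
exact: (measurableT_comp measurable_fst mZ).
Qed.

(** The indicator confines the noise to the region where the variance bound is available. It depends
    on the iterate alone and so is constant throughout a batch. *)
Let noise k (z : Bor * Bor) : R := \1_Reg z.1 * enorm (z.2 - k%:R *: g z.1) ^+ 2.

Let m_noise k dT (T : measurableType dT) (y u : T -> 'rV[R]_n) :
  measurable_fun [set: T] (y : T -> Bor) -> measurable_fun [set: T] (u : T -> Bor) ->
  measurable_fun [set: T] (fun t => noise k (y t, u t)).
Proof.
move=> my mu_; apply: measurable_funM => /=.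
  by apply: (measurableT_comp _ my); exact: measurable_indic.
apply: measurable_enorm_sqr; apply: measurable_rVB => //.
by apply: measurable_rVZ => //; exact: (measurableT_comp mg my).
Qed.

Let noise_ge0 k z : 0 <= noise k z.
Proof. by rewrite mulr_ge0 ?sqr_ge0// indicE. Qed.

(* The samples are conditionally centered, so the cross terms vanish and the
   second moment of the partial sums grows by at most [V] per sample. *)
Let noise_moment t k : (\int[P]_w (noise k (Z t k w))%:E <= (k%:R * V)%:E)%E.
Proof.
elim: k => [|k IH].
  rewrite mul0r integral0_eq// => w _.
  by rewrite /noise /Z /= /batch_sum big_ord0 scale0r subrr enorm0 expr0n mulr0.
have [mZ _] := indep_state t k.
have Lk : later t k (t, k) by right.
have mh : measurable_fun [set: (Bor * Bor) * S]
    (fun z => (noise k.+1 (z.1.1, z.1.2 + G z.1.1 z.2))%:E).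
  apply/measurable_EFinP; apply: m_noise; first exact: measurableT_comp.
  apply: measurable_rVD; first exact: measurableT_comp.
  by apply: mGB => //; exact: measurableT_comp.
have := @indep_samples_integral _ _ _ _ _ P mu _ xi xi_iid _ _ (mfun_of mZ) _ _ Lk
  (indep_state t k) _ mh (fun z => noise_ge0 _ _).
have -> : (fun w => (noise k.+1 ((mfun_of mZ w, xi (t, k) w).1.1,
    (mfun_of mZ w, xi (t, k) w).1.2 +
    G (mfun_of mZ w, xi (t, k) w).1.1 (mfun_of mZ w, xi (t, k) w).2))%:E) =
  (fun w => (noise k.+1 (Z t k.+1 w))%:E).
  by apply/funext => w /=; rewrite /Z /batch_sum big_ord_recr.
move=> ->.
apply: (@le_trans _ _ (\int[P]_w ((noise k (Z t k w))%:E + V%:E)))%E.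
  apply: ge0_le_integral => //.
  - by move=> w _; apply: integral_ge0 => s _; rewrite lee_fin.
  - have mF := measurable_fun_fubini_tonelli_F (m2 := mu) _ mh
      (fun z => noise_ge0 _ _).
    exact: (measurableT_comp mF mZ).
  - apply: emeasurable_funD; last exact: measurable_cst.
    apply/measurable_EFinP.
    apply: m_noise; first exact: iterate_measurable.
    exact: (measurableT_comp measurable_snd mZ).
  move=> w _ /=.
  have [Rx|Rx] := pselect (Reg (x t w)); last first.
    rewrite integral0_eq ?adde_ge0 ?lee_fin// => s _.
    by rewrite /noise indicE memNset// mul0r.
  rewrite /noise /= indicE mem_set// mul1r.
  apply: le_trans (variance_le _ Rx); apply: ge0_le_integral => //.
  - by move=> s _; rewrite lee_fin mulr_ge0 ?sqr_ge0.
  - apply/measurable_EFinP; apply: measurable_funM => //.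
    apply: measurable_enorm_sqr; apply: measurable_rVB => //.
    apply: measurable_rVD; first exact: measurable_cst.
    by apply: mGB.
  - apply/measurable_EFinP; apply: measurable_enorm_sqr.
    apply: measurable_rVD; first exact: measurable_cst.
    by apply: measurable_rVB; [apply: mGB|exact: measurable_cst].
  move=> s _; rewrite lee_fin mul1r le_eqVlt; apply/orP; left; apply/eqP.
  congr (enorm _ ^+ 2); rewrite -natr1 scalerDl scale1r opprD.
  by rewrite addrACA.
rewrite ge0_integralD//; last first.
- apply/measurable_EFinP.
  apply: m_noise; first exact: iterate_measurable.
    exact: (measurableT_comp measurable_snd mZ).
- by move=> w _; rewrite lee_fin.
have -> : (\int[P]__ V%:E = V%:E)%E.
  rewrite (integral_cst P measurableT) -[RHS]mule1; congr (_ * _)%E.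
  exact: probability_setT.
by rewrite -natr1 mulrDl mul1r EFinD leeD.
Qed.

Let gbar t w : 'rV[R]_n := B%:R^-1 *: batch_sum t B w.

Lemma minibatch_gradient_measurable t : measurable_fun [set: Omega] (gbar t : Omega -> Bor).
Proof.
have [mZ _] := indep_state t B.
by apply: measurable_rVZ => //; exact: (measurableT_comp measurable_snd mZ).
Qed.

Lemma minibatch_error_measurable t delta :
  measurable [set w | Reg (x t w) /\ delta ^+ 2 < enorm (gbar t w - g (x t w)) ^+ 2].
Proof.
apply: measurableI.
  by rewrite -[X in measurable X]setTI; apply: iterate_measurable.
rewrite -[X in measurable X]setTI.
apply: (measurable_fun_ltr (measurable_cst _) _ measurableT (_ : measurable [set true])) => //.
apply: measurable_enorm_sqr; apply: measurable_rVB.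
  exact: minibatch_gradient_measurable.
exact: (measurableT_comp mg (iterate_measurable t)).
Qed.

(** Chebyshev's inequality: on the bad event the unnormalised batch error has square above
    [B ^ 2 * delta ^ 2], while its truncated second moment is at most [B * V]. *)
Lemma minibatch_error_prob t delta : 0 < delta ->
  (P [set w | Reg (x t w) /\
      (delta ^+ 2 < enorm (gbar t w - g (x t w)) ^+ 2)%R] <=
   (V / (B%:R * delta ^+ 2))%:E)%E.
Proof.
move=> delta0; set bad := [set w | _].
have mbad : measurable bad := minibatch_error_measurable t delta.
have B0 : 0 < B%:R :> R by rewrite ltr0n.
have c0 : 0 < B%:R ^+ 2 * delta ^+ 2 by rewrite mulr_gt0 ?exprn_gt0.
have H : ((B%:R ^+ 2 * delta ^+ 2)%:E * P bad <= (B%:R * V)%:E)%E.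
  apply: le_trans (noise_moment t B).
  rewrite -[bad]setIT -integral_indic// -ge0_integralZl//; last 2 first.
  - exact/measurable_EFinP/measurable_indic.
  - by rewrite lee_fin ltW.
  have [mZ _] := indep_state t B.
  apply: ge0_le_integral => //.
  - by move=> w _; rewrite mule_ge0// lee_fin ltW.
  - apply/measurable_EFinP; apply: measurable_funM => //; exact: measurable_indic.
  - apply/measurable_EFinP.
    apply: m_noise; first exact: iterate_measurable.
    exact: (measurableT_comp measurable_snd mZ).
  move=> w _; rewrite -EFinM lee_fin indicE.
  have [/set_mem [Rx err]|_] := boolP (w \in bad); last by rewrite mulr0.
  rewrite mulr1 /noise indicE mem_set// mul1r /Z /=.
  have -> : batch_sum t B w - B%:R *: g (x t w) = B%:R *: (gbar t w - g (x t w)).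
    by rewrite scalerBr scalerA divff ?gt_eqF// scale1r.
  by rewrite enormZ exprMn ger0_norm ?(ltW B0)// ler_wpM2l ?sqr_ge0// ltW.
have -> : V / (B%:R * delta ^+ 2) = (B%:R ^+ 2 * delta ^+ 2)^-1 * (B%:R * V).
  by field; rewrite !gt_eqF.
by rewrite EFinM lee_pdivlMl.
Qed.

End MinibatchNoise.

(** * Subexponential functions of the rarity level *)

Section Subexponential.
Variable R : realType.
Implicit Types g h : R -> R.

(** Logarithm-free form of a nonpositive limsup rate; it avoids the value of [lne] at 0 and is
    stable under sums and nonnegative products. *)
Definition subexp g : Prop :=
  forall delta : R, 0 < delta -> \forall l \near +oo, g l <= expR (delta * l).

Lemma subexp_le g h : (\forall l \near +oo, g l <= h l) -> subexp h -> subexp g.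
Proof.
move=> gh sh delta d0; have := sh _ d0; apply: filterS2 gh => l.
exact: le_trans.
Qed.

Lemma subexp_cst c : subexp (fun=> c).
Proof.
move=> delta d0; near=> l.
have l0 : 0 < l by near: l; exact: nbhs_pinfty_gt.
have cl : c / delta <= l by near: l; apply: nbhs_pinfty_ge; rewrite num_real.
rewrite ler_pdivrMr// in cl.
apply: (le_trans cl); rewrite mulrC (le_trans _ (expR_ge1Dx _))//.
by rewrite lerDr.
Unshelve. all: end_near. Qed.

Lemma subexp_normr : subexp (fun l => `|l|).
Proof.
move=> delta d0; near=> l.
have l0 : 0 < l by near: l; exact: nbhs_pinfty_gt.
(* Beyond this threshold [l <= (delta * l / 2) ^ 2], and each factor is at most
   [expR (delta * l / 2)]. *)
have cl : 4 / delta ^+ 2 <= l by near: l; apply: nbhs_pinfty_ge; rewrite num_real.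
rewrite ler_pdivrMr ?exprn_gt0// in cl; rewrite gtr0_norm//.
have -> : delta * l = delta * l / 2 + delta * l / 2 by field.
have h0 : 0 <= delta * l / 2 by rewrite divr_ge0// mulr_ge0 ?ltW.
rewrite expRD; apply: (@le_trans _ _ ((delta * l / 2) * (delta * l / 2))).
  by nra.
by rewrite ler_pM// (le_trans _ (expR_ge1Dx _))// lerDr.
Unshelve. all: end_near. Qed.

Lemma subexpD g h : subexp g -> subexp h -> subexp (fun l => g l + h l).
Proof.
move=> sg sh delta d0.
have d2 : 0 < delta / 2 by rewrite divr_gt0.
near=> l.
have gl : g l <= expR (delta / 2 * l) by near: l; exact: sg.
have hl : h l <= expR (delta / 2 * l) by near: l; exact: sh.
(* Half of the exponent bounds each summand; the other half absorbs the factor 2. *)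
have two : 2 <= expR (delta / 2 * l) by near: l; exact: subexp_cst.
have -> : delta * l = delta / 2 * l + delta / 2 * l by field.
rewrite expRD; nra.
Unshelve. all: end_near. Qed.

Lemma subexpM g h : (forall l, 0 <= g l) -> (forall l, 0 <= h l) ->
  subexp g -> subexp h -> subexp (fun l => g l * h l).
Proof.
move=> g0 h0 sg sh delta d0.
have d2 : 0 < delta / 2 by rewrite divr_gt0.
near=> l.
have gl : g l <= expR (delta / 2 * l) by near: l; exact: sg.
have hl : h l <= expR (delta / 2 * l) by near: l; exact: sh.
have -> : delta * l = delta / 2 * l + delta / 2 * l by field.
by rewrite expRD ler_pM.
Unshelve. all: end_near. Qed.

Lemma subexpZ c g : 0 <= c -> (forall l, 0 <= g l) -> subexp g ->
  subexp (fun l => c * g l).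
Proof. by move=> c0 g0 sg; apply: subexpM => //; exact: subexp_cst. Qed.

Lemma subexpX g n : (forall l, 0 <= g l) -> subexp g -> subexp (fun l => g l ^+ n).
Proof.
move=> g0 sg; elim: n => [|n IH]; first exact: subexp_cst.
under eq_fun do rewrite exprS.
by apply: subexpM => // l; rewrite exprn_ge0.
Qed.

Lemma limsup_log_rate_expR (g : R -> R) (a delta : R) :
  (limsup_log_rate (fun l => (g l)%:E) <= a%:E)%E -> 0 < delta ->
  \forall l \near +oo, g l <= expR ((a + delta) * l).
Proof.
move=> H d0.
have : (limsup_log_rate (fun l => (g l)%:E) < (a + delta)%:E)%E.
  by apply: (le_lt_trans H); rewrite lte_fin ltrDl.
rewrite /limsup_log_rate limf_esupE => /ereal_inf_lt[_ [A nA <-]] supA.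
near=> l.
have l0 : 0 < l by near: l; exact: nbhs_pinfty_gt.
have Al : A l by near: l; exact: nA.
have : (log_rate (fun l => (g l)%:E) l < (a + delta)%:E)%E.
  by apply: le_lt_trans supA; apply: ereal_sup_ubound; exists l.
rewrite /log_rate /=; case: ifPn => [g0 _|]; first exact: (le_trans g0 (expR_ge0 _)).
rewrite -ltNge => g0; rewrite -EFinM lte_fin ltr_pdivrMl// => H1.
by rewrite -[X in X <= _]lnK// ler_expR mulrC ltW.
Unshelve. all: end_near. Qed.

(** Values in [\bar R] are allowed because the sampling complexity is an infimum that may be [+oo]
    at some levels. *)
Lemma limsup_log_rate_le0 (g : R -> \bar R) :
  (forall delta : R, 0 < delta -> \forall l \near +oo, (g l <= (expR (delta * l))%:E)%E) ->
  (limsup_log_rate g <= 0)%E.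
Proof.
move=> H; apply/lee_addgt0Pr => delta d0; rewrite add0e.
rewrite /limsup_log_rate limf_esupE.
set A := [set l | 0 < l /\ (g l <= (expR (delta * l))%:E)%E].
have nA : pinfty_nbhs R A.
  near=> l; split; last by near: l; exact: H.
  by near: l; exact: nbhs_pinfty_gt.
apply: ge_ereal_inf; exists (ereal_sup (log_rate g @` A)); first by exists A.
apply: ge_ereal_sup => _ [l [l0 gl] <-].
rewrite /log_rate.
have : (lne (g l) <= (delta * l)%:E)%E.
  case: (g l) gl => [r||] //=; last by move=> _; rewrite leNye.
  rewrite lee_fin => rl; case: ifPn => [_|]; first by rewrite leNye.
  by rewrite -ltNge => r0; rewrite lee_fin -ler_expR lnK.
move=> H1; apply: (le_trans (lee_wpmul2l _ H1)); first by rewrite lee_fin invr_ge0 ltW.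
by rewrite -EFinM lee_fin mulrCA mulVf ?mulr1// gt_eqF.
Unshelve. all: end_near. Qed.

End Subexponential.

(** * Size of the sublevel set, and the objective on it *)

Section Landscape.
Variables (R : realType) (n : nat).
Implicit Types (f p : 'rV[R]_n -> R) (x y v xt : 'rV[R]_n).

(* Convexity makes [f] grow at least linearly outside the bounded sublevel set. *)
Lemma sublevel_distance f xt epsf df x :
  convex_function [set: 'rV[R]_n] f -> f xt = 0 -> 0 < epsf -> 0 < df ->
  (forall y z, f y <= epsf -> f z <= epsf -> enorm (y - z) <= df) ->
  0 <= f x ->
  enorm (x - xt) <= 2 * df * (1 + f x / epsf).
Proof.
move=> cf f0 e0 d0 diam fx0; set N := enorm (x - xt).
have q0 : 0 <= f x / epsf by rewrite divr_ge0// ltW.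
have [Nd|Nd] := leP N (2 * df).
  by rewrite (le_trans Nd)// ler_peMr ?mulr_ge0 ?(ltW d0)// lerDl.
have N0 : 0 < N by apply: lt_trans Nd; rewrite mulr_gt0.
(* The point of the segment at distance [2 * df] from [xt] is farther away than the diameter, hence
   outside the sublevel set; convexity carries [epsf < f y] on to [x]. *)
set s := 2 * df / N.
have s0 : 0 <= s by rewrite divr_ge0 ?mulr_ge0 ?ltW.
have s1 : s <= 1 by rewrite ler_pdivrMr// mul1r ltW.
set y := xt + s *: (x - xt).
have yN : enorm (y - xt) = 2 * df.
  by rewrite /y addrAC subrr add0r enormZ ger0_norm// divfK// gt_eqF.
have fy : epsf < f y.
  rewrite ltNge; apply/negP => fy.
  have := diam y xt fy; rewrite f0 (ltW e0) yN => /(_ isT); lra.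
have := convex_functionE xt x cf (t := s); rewrite s0 s1 -/y f0 => /(_ isT).
rewrite add0r subr0 => fys.
have : epsf < s * f x by exact: lt_le_trans fy fys.
rewrite /s mulrAC ltr_pdivlMr// => H.
have : N < 2 * df * (f x / epsf).
  by rewrite mulrA ltr_pdivlMr// mulrC.
by rewrite mulrDr mulr1 => /ltW H1; rewrite (le_trans H1)// lerDr mulr_ge0 ?ltW.
Qed.

(** Trades the real exponents of the relative bounds for one natural exponent, for which closure
    under products gives subexponential growth. *)
Lemma powR_le_exprn (a A b : R) (m : nat) :
  0 <= a -> a <= A -> 1 <= A -> 0 <= b -> b <= m%:R -> a `^ b <= A ^+ m.
Proof.
move=> a0 aA A1 b0 bm; rewrite -powR_mulrn ?(le_trans ler01 A1)//.
apply: (@le_trans _ _ (A `^ b)); last exact: ler_powR.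
by apply: ge0_ler_powR; rewrite ?nnegrE// (le_trans a0).
Qed.

Section Level.
Variables (f p : 'rV[R]_n -> R) (xt : 'rV[R]_n) (c Lf L1 L2 P1 D M : R).
Hypothesis c_gt0 : 0 < c.
Hypothesis f_ge0 : forall x, 0 <= f x.
Hypothesis p_ge0 : forall x, 0 <= p x.
Hypothesis f_C2 : twice_cont_diff f.
Hypothesis p_C2 : twice_cont_diff p.
Hypothesis Lf_ge0 : 0 <= Lf.
Hypothesis L1_ge0 : 0 <= L1.
Hypothesis L2_ge0 : 0 <= L2.
Hypothesis P1_ge0 : 0 <= P1.
Hypothesis f_hess : forall x, specnorm (hess f x) <= Lf.
Hypothesis p_grad : forall x, enorm (x - xt) <= D + 1 ->
  enorm (grad p x) <= L1 * P1 * p x.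
Hypothesis p_hess : forall x, enorm (x - xt) <= D + 1 ->
  specnorm (hess p x) <= L2 * P1 * p x.
Hypothesis sublevel_D : forall x, f x + c * p x <= M -> enorm (x - xt) <= D.

Let cp_le x : f x + c * p x <= M -> c * p x <= M.
Proof. by apply: le_trans; rewrite lerDr. Qed.

(** The relative bound turns the gradient into [p], and [c * p x] is at most the objective; so the
    bound does not involve the possibly huge weight [c]. *)
Lemma level_grad_p x : f x + c * p x <= M ->
  c * enorm (grad p x) <= L1 * P1 * M.
Proof.
move=> Fx.
have xD : enorm (x - xt) <= D + 1 by rewrite (le_trans (sublevel_D Fx))// lerDl.
apply: (@le_trans _ _ (L1 * P1 * (c * p x))).
  by rewrite mulrCA ler_wpM2l ?(ltW c_gt0)// p_grad.
by rewrite ler_wpM2l ?mulr_ge0// cp_le.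
Qed.

Lemma level_grad x : f x + c * p x <= M ->
  enorm (grad f x + c *: grad p x) <=
  enorm (grad f xt) + Lf * D + L1 * P1 * M.
Proof.
move=> Fx; apply: (le_trans (enormD _ _)); apply: lerD; last first.
  by rewrite enormZ gtr0_norm// level_grad_p.
apply: (le_trans (grad_lipschitz_at xt x Lf_ge0 f_C2 f_hess)).
by rewrite lerD2l ler_wpM2l// sublevel_D.
Qed.

(** The radius gives both [enorm v <= 1] and [L1 * P1 * enorm v <= 1 / 2]. The first keeps the
    segment, which may leave the sublevel set, within distance [D + 1] of [xt]; the second lets [p]
    at most double along it, whence the factor 2 in the smoothness constant. *)
Lemma level_descent x v : f x + c * p x <= M ->
  enorm v <= (1 + 2 * (L1 * P1))^-1 ->
  f (x + v) + c * p (x + v) <= f x + c * p x +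
    dot (grad f x + c *: grad p x) v +
    (Lf + 2 * (L2 * P1 * M)) * enorm v ^+ 2.
Proof.
move=> Fx vr; have v0 := enorm_ge0 v.
have LP0 : 0 <= L1 * P1 by rewrite mulr_ge0.
have LP1 : 0 < 1 + 2 * (L1 * P1) by rewrite ltr_pwDl// mulr_ge0.
have v1 : enorm v <= 1.
  by rewrite (le_trans vr)// invf_le1// lerDl mulr_ge0.
have vLP : L1 * P1 * enorm v <= 2^-1.
  move: vr; rewrite -[_^-1]mul1r ler_pdivlMr// => vr; lra.
have dotle (A : 'M[R]_n) b : specnorm A <= b -> dot (v *m A) v <= b * enorm v ^+ 2.
  move=> Ab; apply: (le_trans (dot_le _ _)); rewrite expr2 mulrA ler_wpM2r//.
  by rewrite (le_trans (enorm_mulmx_le _ _))// ler_wpM2r.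
have near_D s : 0 <= s <= 1 -> enorm (x + s *: v - xt) <= D + 1.
  move=> /andP[s0 s1]; rewrite addrAC (le_trans (enormD _ _))// lerD ?sublevel_D//.
  by rewrite enormZ ger0_norm// (le_trans _ v1)// ler_piMl.
have growth s : 0 <= s <= 1 -> p (x + s *: v) <= 2 * p x.
  have [dp _ _] := p_C2; apply: segment_growth => // r r01.
  apply: (le_trans (dot_le _ _)).
  apply: (@le_trans _ _ (L1 * P1 * p (x + r *: v) * enorm v)).
    by rewrite ler_wpM2r// p_grad// near_D.
  by rewrite mulrAC mulrC ler_wpM2l.
have f_step : f (x + v) <= f x + dot (grad f x) v + Lf * enorm v ^+ 2.
  by apply: segment_taylor => // [s _|]; [exact: dotle|rewrite mulr_ge0// sqr_ge0].
have p_step : p (x + v) <= p x + dot (grad p x) v + L2 * P1 * (2 * p x) * enorm v ^+ 2.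
  apply: segment_taylor => // [s s01|]; last by rewrite mulr_ge0 ?sqr_ge0// !mulr_ge0.
  apply: dotle; rewrite (le_trans (p_hess (near_D _ s01)))//.
  by rewrite ler_wpM2l ?mulr_ge0// growth.
have {}p_step := ler_wpM2l (ltW c_gt0) p_step.
have : L2 * P1 * (c * p x) * enorm v ^+ 2 <= L2 * P1 * M * enorm v ^+ 2.
  by rewrite ler_wpM2r ?sqr_ge0// ler_wpM2l ?mulr_ge0// cp_le.
rewrite dotDl dotZl; lra.
Qed.

End Level.

End Landscape.

(** * Variance of the combined gradient estimator *)

Section GradientVariance.
Context (R : realType) (n : nat) (d : measure_display) (S : measurableType d).
Variable mu : probability S R.
Implicit Types (G : S -> 'rV[R]_n) (v a : 'rV[R]_n).

Let integral_EFinD (u w : S -> R) :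
  mu.-integrable setT (EFin \o u) -> mu.-integrable setT (EFin \o w) ->
  (\int[mu]_s (u s + w s)%:E = \int[mu]_s (u s)%:E + \int[mu]_s (w s)%:E)%E.
Proof. by move=> iu iw; under eq_integral do rewrite EFinD; rewrite integralD. Qed.

Let integral_EFinZ (k : R) (u : S -> R) : mu.-integrable setT (EFin \o u) ->
  (\int[mu]_s (k * u s)%:E = k%:E * \int[mu]_s (u s)%:E)%E.
Proof. by move=> iu; under eq_integral do rewrite EFinM; rewrite integralZl. Qed.

Let integral_EFin_cst (k : R) : (\int[mu]_s k%:E = k%:E)%E.
Proof.
rewrite (integral_cst mu measurableT) -[RHS]mule1; congr (_ * _)%E.
exact: probability_setT.
Qed.

Let integrable_EFin_cst (k : R) : mu.-integrable setT (EFin \o cst k : S -> \bar R).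
Proof. exact: finite_measure_integrable_cst. Qed.

Let integrable_EFinZ (k : R) (u : S -> R) : mu.-integrable setT (EFin \o u) ->
  mu.-integrable setT (EFin \o (fun s => k * u s)).
Proof.
move=> iu; have := integrableZl measurableT k iu.
by apply: eq_integrable => // s _; rewrite /= EFinM.
Qed.

Let integrable_EFinD (u w : S -> R) :
  mu.-integrable setT (EFin \o u) -> mu.-integrable setT (EFin \o w) ->
  mu.-integrable setT (EFin \o (fun s => u s + w s)).
Proof.
move=> iu iw; have := integrableD measurableT iu iw.
by apply: eq_integrable => // s _; rewrite /= EFinD.
Qed.

Lemma unbiased_lincomb G1 G2 v1 v2 (c : R) :
  unbiased mu G1 v1 -> unbiased mu G2 v2 ->
  unbiased mu (fun s => G1 s + c *: G2 s) (v1 + c *: v2).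
Proof.
move=> u1 u2 i; have [i1 E1] := u1 i; have [i2 E2] := u2 i.
have E : (fun s => (G1 s + c *: G2 s) 0 i) = (fun s => G1 s 0 i + c * G2 s 0 i).
  by apply/funext => s; rewrite !mxE.
rewrite unlock in E1; rewrite unlock in E2.
split.
  have -> : (fun s => ((G1 s + c *: G2 s) 0 i)%:E) =
      EFin \o (fun s => G1 s 0 i + c * G2 s 0 i).
    by apply/funext => s /=; rewrite !mxE.
  by apply: integrable_EFinD => //; exact: integrable_EFinZ.
rewrite E unlock integral_EFinD//; last exact: integrable_EFinZ.
rewrite integral_EFinZ// E1 E2 !mxE.
by rewrite -EFinM -EFinD.
Qed.

Lemma centered_second_moment G v a (V : R) :
  (forall i, measurable_fun [set: S] (fun s => G s 0 i)) ->
  unbiased mu G v ->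
  (\int[mu]_s (enorm (G s - v) ^+ 2)%:E <= V%:E)%E ->
  (\int[mu]_s (enorm (a + (G s - v)) ^+ 2)%:E <= (enorm a ^+ 2 + V)%:E)%E.
Proof.
move=> mG uG GV.
(* The cross term [2 * dot a (G s - v)], restricted to a list of coordinates so that integrability
   and zero mean follow by induction. *)
pose lin (r : seq 'I_n) s := \sum_(i <- r) (2 * a 0 i) * (G s 0 i - v 0 i).
have lin0 r : mu.-integrable setT (EFin \o lin r) /\ (\int[mu]_s (lin r s)%:E = 0)%E.
  elim: r => [|i r [ir Er]].
    have -> : lin [::] = cst 0 by apply/funext => s; rewrite /lin big_nil.
    by split; [exact: integrable_EFin_cst|exact: (integral_EFin_cst 0)].
  have -> : lin (i :: r) = (fun s => 2 * a 0 i * (G s 0 i + - v 0 i) + lin r s).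
    by apply/funext => s; rewrite /lin big_cons.
  have [iG EG] := uG i; rewrite unlock in EG.
  have iGv : mu.-integrable setT (EFin \o (fun s => G s 0 i + - v 0 i)).
    by apply: integrable_EFinD => //; exact: integrable_EFin_cst.
  split.
    by apply: integrable_EFinD => //; exact: integrable_EFinZ.
  rewrite integral_EFinD//; last exact: integrable_EFinZ.
  rewrite Er adde0 integral_EFinZ// integral_EFinD//; last exact: integrable_EFin_cst.
  by rewrite EG integral_EFin_cst -EFinD subrr mule0.
have [il El] := lin0 (index_enum 'I_n).
have mY : measurable_fun [set: S] (fun s => enorm (G s - v) ^+ 2).
  apply: measurable_enorm_sqr; apply: measurable_rVB; last exact: measurable_cst.
  exact: rV_borel_measurable.
have iY : mu.-integrable setT (EFin \o (fun s => enorm (G s - v) ^+ 2)).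
  apply/integrableP; split; first exact/measurable_EFinP.
  under eq_integral do rewrite /= ger0_norm ?sqr_ge0//.
  by apply: le_lt_trans GV _; rewrite ltry.
have E s : enorm (a + (G s - v)) ^+ 2 =
    enorm a ^+ 2 + (lin (index_enum 'I_n) s + enorm (G s - v) ^+ 2).
  rewrite enormD_sqr.
  have -> : lin (index_enum 'I_n) s = 2 * dot a (G s - v).
    by rewrite mulr_sumr; apply: eq_bigr => i _; rewrite !mxE mulrA.
  by rewrite addrA.
under eq_integral do rewrite E.
rewrite integral_EFinD; first last.
- exact: integrable_EFinD.
- exact: integrable_EFin_cst.
rewrite integral_EFinD// El add0e integral_EFin_cst EFinD.
exact: leeD.
Qed.

(** Both estimators read the same sample and may be correlated, so the squares are separated by
    [enormDsqr_le], at the price of a factor 2. *)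
Lemma lincomb_second_moment G1 G2 v1 v2 (c V1 V2 : R) :
  (forall i, measurable_fun [set: S] (fun s => G1 s 0 i)) ->
  (forall i, measurable_fun [set: S] (fun s => G2 s 0 i)) ->
  (\int[mu]_s (enorm (G1 s - v1) ^+ 2)%:E <= V1%:E)%E ->
  (\int[mu]_s (enorm (G2 s - v2) ^+ 2)%:E <= V2%:E)%E ->
  (\int[mu]_s (enorm (G1 s + c *: G2 s - (v1 + c *: v2)) ^+ 2)%:E <=
   (2 * V1 + 2 * (c ^+ 2 * V2))%:E)%E.
Proof.
move=> mG1 mG2 H1 H2.
have mY (G : S -> 'rV[R]_n) v : (forall i, measurable_fun [set: S] (fun s => G s 0 i)) ->
    measurable_fun [set: S] (fun s => enorm (G s - v) ^+ 2).
  move=> mG; apply: measurable_enorm_sqr; apply: measurable_rVB; last exact: measurable_cst.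
  exact: rV_borel_measurable.
apply: (@le_trans _ _ (\int[mu]_s (2%:E * (enorm (G1 s - v1) ^+ 2)%:E +
    (2 * c ^+ 2)%:E * (enorm (G2 s - v2) ^+ 2)%:E)))%E.
  apply: ge0_le_integral => //.
  - by move=> s _; rewrite lee_fin sqr_ge0.
  - apply/measurable_EFinP; apply: mY => i.
    under eq_fun do rewrite !mxE.
    by apply: measurable_funD => //; apply: measurable_funM.
  - apply: emeasurable_funD; apply/measurable_EFinP; apply: measurable_funM => //; exact: mY.
  move=> s _; rewrite -!EFinM -EFinD lee_fin.
  have -> : G1 s + c *: G2 s - (v1 + c *: v2) = (G1 s - v1) + c *: (G2 s - v2).
    by rewrite opprD addrACA scalerBr.
  apply: (le_trans (enormDsqr_le _ _)).
  by rewrite enormZ exprMn real_normK ?num_real// [2 * (c ^+ 2 * _)]mulrA.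
have m1 : measurable_fun setT (fun s => (enorm (G1 s - v1) ^+ 2)%:E).
  exact/measurable_EFinP/mY.
have m2 : measurable_fun setT (fun s => (enorm (G2 s - v2) ^+ 2)%:E).
  exact/measurable_EFinP/mY.
have c2 : (0 <= (2 * c ^+ 2)%:E)%E by rewrite lee_fin mulr_ge0 ?sqr_ge0.
rewrite ge0_integralD//; first last.
- exact: measurable_funeM.
- by move=> s _; rewrite mule_ge0// lee_fin sqr_ge0.
- exact: measurable_funeM.
- by move=> s _; rewrite mule_ge0// lee_fin sqr_ge0.
rewrite !ge0_integralZl//; first last.
- by move=> s _; rewrite lee_fin sqr_ge0.
- by move=> s _; rewrite lee_fin sqr_ge0.
rewrite [leRHS]EFinD leeD//; first by rewrite [leRHS]EFinM lee_wpmul2l.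
by rewrite [2 * (c ^+ 2 * V2)]mulrA [leRHS]EFinM lee_wpmul2l.
Qed.

End GradientVariance.

(** * From batch errors to success with high probability *)

Section HighProbability.
Context (R : realType) (n : nat) (d d' : measure_display)
  (Omega : measurableType d) (S : measurableType d').
Variables (P : probability Omega R) (mu : probability S R)
  (xi : nat * nat -> Omega -> S).
Hypothesis xi_iid : iid P mu xi.

Let Bor : measurableType _ := g_sigma_algebraType (@open 'rV[R]_n).

Variables (F : 'rV[R]_n -> R) (g : 'rV[R]_n -> 'rV[R]_n)
  (G : 'rV[R]_n -> S -> 'rV[R]_n).
Variables (xs x0 : 'rV[R]_n) (M r L Gam D V delta eta0 : R) (B T : nat)
  (eta : nat -> R) (x : nat -> Omega -> 'rV[R]_n).
Hypothesis mF : measurable_fun [set: Bor] F.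
Hypothesis mg : measurable_fun [set: Bor] (g : Bor -> Bor).
Hypothesis mG : jointly_measurable G.
Hypothesis g_subgrad : forall a b, F a + dot (g a) (b - a) <= F b.
Hypothesis descent : forall a v, F a <= M -> enorm v <= r ->
  F (a + v) <= F a + dot (g a) v + L * enorm v ^+ 2.
Hypothesis g_bounded : forall a, F a <= M -> enorm (g a) <= Gam.
Hypothesis sublevel_dist : forall a, F a <= M -> enorm (a - xs) <= D.
Hypothesis variance_le : forall y a, F y <= M ->
  (\int[mu]_s (enorm (a + (G y s - g y)) ^+ 2)%:E <= (enorm a ^+ 2 + V)%:E)%E.
Hypothesis V_ge0 : 0 <= V.
Hypothesis L_ge0 : 0 <= L.
Hypothesis D_ge0 : 0 <= D.
Hypothesis delta_gt0 : 0 < delta.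
Hypothesis eta0_r : eta0 * (Gam + delta) <= r.
Hypothesis eta0_L : eta0 * (2 * L) <= 1.
Hypothesis eta_gt0 : forall t, 0 < eta t.
Hypothesis eta_le : forall t, eta t <= eta0.
Hypothesis B_gt0 : (0 < B)%N.
Hypothesis T_gt0 : (0 < T)%N.
Hypothesis M_large : F x0 + T%:R * (eta0 * delta ^+ 2) <= M.
Hypothesis x_0 : forall w, x 0 w = x0.
Hypothesis x_S : forall t w, x t.+1 w = x t w -
  eta t *: (B%:R^-1 *: \sum_(i < B) G (x t w) (xi (t, i : nat) w)).

Let err t w := B%:R^-1 *: \sum_(i < B) G (x t w) (xi (t, i : nat) w) - g (x t w).
(** Requiring [F (x t w) <= M] gives access to the variance bound, and outside all bad events
    exactly the error hypothesis of the deterministic analysis remains. *)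
Let bad t := [set w | F (x t w) <= M /\ delta ^+ 2 < enorm (err t w) ^+ 2].

Let mReg : measurable ([set y | F y <= M] : set Bor).
Proof.
rewrite -[X in measurable X]setTI.
have := measurable_fun_ler mF (measurable_cst M) measurableT (_ : measurable [set true]).
  exact.
Qed.

Let mbad t : measurable (bad t).
Proof. exact: (minibatch_error_measurable xi_iid mG mg mReg x_0 x_S). Qed.

Let Pbad t : (P (bad t) <= (V / (B%:R * delta ^+ 2))%:E)%E.
Proof.
exact: (minibatch_error_prob xi_iid mG mg mReg V_ge0 B_gt0 variance_le x_0 x_S).
Qed.

Let mx t : measurable_fun [set: Omega] (x t : Omega -> Bor).
Proof. exact: (iterate_measurable xi_iid mG x_0 x_S). Qed.

Let gap := D ^+ 2 / (\sum_(t < T) eta t) + delta * D + T%:R * (eta0 * delta ^+ 2).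

Let success_of_good (y : Omega -> 'rV[R]_n) c :
  measurable_fun [set: Omega] (y : Omega -> Bor) ->
  (forall w, (forall t, (t < T)%N -> F (x t w) <= M -> enorm (err t w) <= delta) ->
    F (y w) <= c) ->
  ((1 - T%:R * (V / (B%:R * delta ^+ 2)))%:E <= P [set w | (F (y w) <= c)%R])%E.
Proof.
move=> my Fy.
pose U := \big[setU/set0]_(t < T) bad t.
have mU : measurable U by apply: bigsetU_measurable.
have PU : (P U <= (T%:R * (V / (B%:R * delta ^+ 2)))%:E)%E.
  have PU := Boole_inequality P (fun t (_ : (t < T)%N) => mbad t).
  apply: (le_trans PU).
  apply: (@le_trans _ _ (\sum_(t < T) (V / (B%:R * delta ^+ 2))%:E)%E).
    by apply: lee_sum => t _; exact: Pbad.
  by rewrite sumEFin sumr_const card_ord [X in (_ <= X%:E)%E]mulr_natl lexx.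
have mS : measurable [set w | F (y w) <= c].
  rewrite -[X in measurable X]setTI.
  have mFy := measurableT_comp mF my.
  have := measurable_fun_ler mFy (measurable_cst c) measurableT (_ : measurable [set true]).
  exact.
apply: (@le_trans _ _ (P (~` U))).
  rewrite probability_setC// EFinB leeD2l// leeN2//.
apply: le_measure; rewrite ?inE//; first exact: measurableC.
move=> w Uw; apply: Fy => t tT Ft; rewrite leNgt; apply/negP => de.
apply: Uw; rewrite /U -bigcup_mkord; exists t => //; split=> //.
by rewrite ltr_pXn2r ?nnegrE ?enorm_ge0 ?(ltW delta_gt0).
Qed.

Let xS' w t : x t.+1 w = x t w - eta t *: (g (x t w) + err t w).
Proof. by rewrite x_S /err addrC [g _ + _]addrC subrK addrC. Qed.

Let M_large' w : F (x 0 w) + T%:R * (eta0 * delta ^+ 2) <= M.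
Proof. by rewrite x_0. Qed.

Lemma last_output_prob c : F xs + gap <= c ->
  ((1 - T%:R * (V / (B%:R * delta ^+ 2)))%:E <= P [set w | (F (x T w) <= c)%R])%E.
Proof.
move=> gc; apply: success_of_good => // w e_small.
apply: le_trans gc; rewrite /gap addrA.
exact: (last_gap g_subgrad descent g_bounded sublevel_dist (ltW delta_gt0) D_ge0
  eta0_r eta0_L L_ge0 eta_gt0 eta_le (xS' w) e_small (M_large' w) T_gt0).
Qed.

Lemma avg_output_prob c : F xs + gap <= c ->
  ((1 - T%:R * (V / (B%:R * delta ^+ 2)))%:E <=
   P [set w | (F (avg_output eta (x ^~ w) T) <= c)%R])%E.
Proof.
move=> gc; apply: success_of_good => [|w e_small].
  rewrite /avg_output gtn_eqF//; apply: measurable_rVZ => //.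
  by apply: measurable_rV_sum => t; apply: measurable_rVZ => //; exact: mx.
apply: le_trans gc; rewrite /gap addrA.
apply: le_trans (avg_gap g_subgrad descent g_bounded sublevel_dist (ltW delta_gt0) D_ge0
  eta0_r eta0_L L_ge0 eta_gt0 eta_le (xS' w) e_small (M_large' w) T_gt0) _.
rewrite lerDl mulr_ge0// mulr_ge0 ?sqr_ge0//.
by rewrite (le_trans _ (eta_le 0)) ?ltW.
Qed.

End HighProbability.

(** * Parameters of a scheme at a fixed rarity level *)

Section LevelSuccess.
Variable R : realType.

(** Each of the [T] terms is at least the last one, [T ^ (- alpha)], because [1 + t <= T]. *)
Lemma sum_poly_steps (alpha : R) (T : nat) : 0 <= alpha -> (0 < T)%N ->
  T%:R `^ (1 - alpha) <= \sum_(t < T) (1 + t%:R) `^ (- alpha).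
Proof.
move=> a0 T0; have TR : 0 < T%:R :> R by rewrite ltr0n.
rewrite powRD; last by rewrite (gt_eqF TR) implybT.
rewrite powRr1 ?ler0n//; apply: (@le_trans _ _ (\sum_(t < T) T%:R `^ (- alpha))).
  by rewrite sumr_const card_ord mulr_natl lexx.
apply: ler_sum => t _; rewrite !powRN lef_pV2 ?posrE ?powR_gt0 ?ltr_wpDr//.
apply: ge0_ler_powR; rewrite ?nnegrE ?addr_ge0//.
by rewrite addrC natr1 ler_nat.
Qed.

Context (n : nat) (d d' : measure_display)
  (Omega : measurableType d) (S : measurableType d').
Variables (P : probability Omega R) (mu : probability S R)
  (xi : nat * nat -> Omega -> S).
Hypothesis xi_iid : iid P mu xi.

Let Bor : measurableType _ := g_sigma_algebraType (@open 'rV[R]_n).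

Variables (F : 'rV[R]_n -> R) (g : 'rV[R]_n -> 'rV[R]_n)
  (Gf : 'rV[R]_n -> S -> 'rV[R]_n) (Gp : R -> 'rV[R]_n -> S -> 'rV[R]_n).
Variables (gamma : R -> R) (l : R).
Let G y s := Gf y s + gamma l *: Gp l y s.
Variables (xs x0 : 'rV[R]_n) (M r L Gam D V K alpha : R) (T m : nat).
Variable A : scheme R n.
Hypothesis mF : measurable_fun [set: Bor] F.
Hypothesis mg : measurable_fun [set: Bor] (g : Bor -> Bor).
Hypothesis mG : jointly_measurable G.
Hypothesis g_subgrad : forall a b, F a + dot (g a) (b - a) <= F b.
Hypothesis descent : forall a v, F a <= M -> enorm v <= r ->
  F (a + v) <= F a + dot (g a) v + L * enorm v ^+ 2.
Hypothesis g_bounded : forall a, F a <= M -> enorm (g a) <= Gam.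
Hypothesis sublevel_dist : forall a, F a <= M -> enorm (a - xs) <= D.
Hypothesis variance_le : forall y a, F y <= M ->
  (\int[mu]_s (enorm (a + (G y s - g y)) ^+ 2)%:E <= (enorm a ^+ 2 + V)%:E)%E.
Hypothesis V_ge0 : 0 <= V.
Hypothesis L_ge0 : 0 <= L.
Hypothesis D_ge0 : 0 <= D.
Hypothesis alpha_ge0 : 0 <= alpha.
Hypothesis alpha_lt1 : alpha < 1.
Hypothesis K_ge1 : 1 <= K.
Hypothesis F_x0 : F x0 + 1 <= M.
Hypothesis Gam_le : Gam + 1 <= K.
Hypothesis r_ge : K^-1 <= r.
Hypothesis L_le : 2 * L <= K.
Hypothesis D_le : D <= K.
Hypothesis V_le : V <= K.
Hypothesis m_large : 5 <= m%:R * (1 - alpha).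
Hypothesis T_large : K ^+ m <= T%:R.
Hypothesis stepsizeE :
  stepsize A = (fun t : nat => (K ^+ 2)^-1 * (1 + t%:R) `^ (- alpha)).
Hypothesis B_large : T%:R ^+ 3 * K ^+ 6 <= (batch A)%:R.
Hypothesis outputE : output A = @last_output R n \/ output A = avg_output (stepsize A).

Let K_gt0 : 0 < K. Proof. exact: lt_le_trans K_ge1. Qed.

Let T_ge1 : 1 <= T%:R :> R.
Proof. by apply: le_trans T_large; rewrite exprn_ege1. Qed.

Let T_gt0 : (0 < T)%N. Proof. by rewrite -(ltr0n R) (lt_le_trans _ T_ge1). Qed.

Let B_gt0 : (0 < batch A)%N.
Proof.
rewrite -(ltr0n R); apply: lt_le_trans B_large.
by rewrite mulr_gt0// exprn_gt0// ltr0n.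
Qed.

(** Origin of the 5 in [m_large]: the initial step costs two powers of [K], and the three that
    remain give [D ^ 2 / W <= K ^ 2 / K ^ 3]. *)
Let W_ge : K ^+ 3 <= \sum_(t < T) stepsize A t.
Proof.
rewrite stepsizeE -mulr_sumr ler_pdivlMl ?exprn_gt0// -exprD.
apply: le_trans (sum_poly_steps alpha_ge0 T_gt0).
have a1 : 0 <= 1 - alpha by rewrite subr_ge0 ltW.
apply: (@le_trans _ _ ((K ^+ m) `^ (1 - alpha))).
  rewrite -!powR_mulrn ?(ltW K_gt0)// -powRrM.
  by apply: ler_powR.
by apply: ge0_ler_powR; rewrite ?nnegrE ?exprn_ge0 ?(ltW K_gt0).
Qed.

(** The 3 counts three errors of at most [1 / K] each: the regret term [D ^ 2 / W], the bias
    [delta * D], and the drift over [T] steps. *)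
Lemma level_success c : F xs + 3 / K <= c ->
  ((1 - K^-1)%:E <=
   P [set w | (F (sgd_output Gf Gp gamma setT l A x0 xi T w) <= c)%R])%E.
Proof.
move=> Fc.
pose x t w := sgd_path Gf Gp gamma setT l A x0 (fun t i => xi (t, i) w) t.
have x_0 w : x 0 w = x0 by [].
have x_S t w : x t.+1 w = x t w - stepsize A t *:
    ((batch A)%:R^-1 *: \sum_(i < batch A) G (x t w) (xi (t, i : nat) w)).
  by rewrite /x /= proj_setT.
pose delta : R := (T%:R * K ^+ 2)^-1.
have TR0 : 0 < T%:R :> R by rewrite ltr0n.
have TK0 : 0 < T%:R * K ^+ 2 by rewrite mulr_gt0// exprn_gt0.
have K2 : 1 <= K ^+ 2 by rewrite exprn_ege1.
have delta0 : 0 < delta by rewrite invr_gt0.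
have delta1 : delta <= 1.
  by rewrite invf_le1// (le_trans K2)// ler_peMl// exprn_ge0// ltW.
have K3W := W_ge.
have K_K2 : K <= K ^+ 2 by rewrite expr2 ler_peMl// ltW.
have eta0_r : (K ^+ 2)^-1 * (Gam + delta) <= r.
  apply: le_trans r_ge; rewrite ler_pdivrMl ?exprn_gt0//.
  by rewrite expr2 mulfK ?gt_eqF// (le_trans _ Gam_le)// lerD2l.
have eta0_L : (K ^+ 2)^-1 * (2 * L) <= 1.
  by rewrite ler_pdivrMl ?exprn_gt0// mulr1 (le_trans L_le).
have eta_gt0 t : 0 < stepsize A t.
  by rewrite stepsizeE mulr_gt0 ?invr_gt0 ?exprn_gt0// powR_gt0// ltr_wpDr.
have eta_le t : stepsize A t <= (K ^+ 2)^-1.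
  rewrite stepsizeE ler_piMr ?invr_ge0 ?exprn_ge0 ?(ltW K_gt0)//.
  rewrite powRN invf_le1 ?powR_gt0 ?ltr_wpDr//.
  have p1 : 1 `^ alpha = 1 :> R by rewrite powR1.
  rewrite -[X in X <= _]p1; apply: ge0_ler_powR; rewrite ?nnegrE ?addr_ge0//.
  by rewrite lerDl.
have drift : T%:R * ((K ^+ 2)^-1 * delta ^+ 2) <= K^-1.
  have -> : T%:R * ((K ^+ 2)^-1 * delta ^+ 2) = (T%:R * K ^+ 6)^-1.
    by rewrite /delta; field; rewrite !gt_eqF.
  rewrite lef_pV2 ?posrE ?mulr_gt0 ?exprn_gt0//.
  have : K <= K ^+ 6 by rewrite -[X in X <= _]expr1 ler_weXn2l.
  by move=> KK; rewrite (le_trans KK)// ler_peMl// exprn_ge0// ltW.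
have K_inv1 : K^-1 <= 1 by rewrite invf_le1.
have M_large : F x0 + T%:R * ((K ^+ 2)^-1 * delta ^+ 2) <= M.
  by apply: le_trans F_x0; rewrite lerD2l (le_trans drift).
have gapK : F xs + (D ^+ 2 / (\sum_(t < T) stepsize A t) + delta * D +
    T%:R * ((K ^+ 2)^-1 * delta ^+ 2)) <= c.
  apply: le_trans Fc; rewrite lerD2l.
  have -> : 3 / K = K^-1 + K^-1 + K^-1 by field; rewrite gt_eqF.
  rewrite lerD// lerD//.
    rewrite ler_pdivrMr; last by rewrite (lt_le_trans _ K3W)// exprn_gt0.
    apply: (@le_trans _ _ (K ^+ 2)); first by rewrite lerXn2r// nnegrE ltW.
    by rewrite -(ler_pM2l K_gt0) mulVKf ?gt_eqF// -exprS.
  rewrite /delta ler_pdivrMl//.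
  apply: (le_trans D_le).
  have -> : T%:R * K ^+ 2 / K = T%:R * K by field; rewrite gt_eqF.
  by rewrite ler_peMl// ltW.
(* With [delta = 1 / (T * K ^ 2)] the union bound equals [T ^ 3 * K ^ 4 * V / B]; since [V <= K], a
   batch of [T ^ 3 * K ^ 6] brings it down to [1 / K]. *)
have probK : T%:R * (V / ((batch A)%:R * delta ^+ 2)) <= K^-1.
  have BR0 : 0 < (batch A)%:R :> R by rewrite ltr0n.
  have -> : T%:R * (V / ((batch A)%:R * delta ^+ 2)) =
      T%:R ^+ 3 * K ^+ 4 * V / (batch A)%:R.
    by rewrite /delta; field; rewrite !gt_eqF.
  rewrite ler_pdivrMr// ler_pdivlMl//.
  apply: le_trans B_large.
  have -> : T%:R ^+ 3 * K ^+ 6 = K * (T%:R ^+ 3 * K ^+ 4 * K) by ring.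
  by rewrite ler_wpM2l ?(ltW K_gt0)// ler_wpM2l// mulr_ge0// exprn_ge0// ltW.
apply: (@le_trans _ _ (1 - T%:R * (V / ((batch A)%:R * delta ^+ 2)))%:E).
  by rewrite lee_fin lerD2l lerN2.
rewrite /sgd_output; case: outputE => ->.
  exact: (last_output_prob xi_iid mF mg mG g_subgrad descent g_bounded sublevel_dist
    variance_le V_ge0 L_ge0 D_ge0 delta0 eta0_r eta0_L eta_gt0 eta_le B_gt0 T_gt0
    M_large x_0 x_S gapK).
exact: (avg_output_prob xi_iid mF mg mG g_subgrad descent g_bounded sublevel_dist
    variance_le V_ge0 L_ge0 D_ge0 delta0 eta0_r eta0_L eta_gt0 eta_le B_gt0 T_gt0
    M_large x_0 x_S gapK).
Qed.

End LevelSuccess.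

(** * Consequences of the logarithmic rates for the objective *)

Section LogRates.
Context (R : realType) (n : nat).
Variables (f p : 'rV[R]_n -> R) (gamma : R -> R).

(** A finite limit excludes the value [-oo], hence nonpositive [h l]; a negative limit forces
    exponential decay. *)
Lemma log_rate_cvg_neg (h : R -> R) (I : R) : 0 < I ->
  log_rate (fun l => (h l)%:E) l @[l --> +oo] --> (- I)%:E ->
  (\forall l \near +oo, 0 < h l) /\
  (forall c, 0 < c -> \forall l \near +oo, h l < c).
Proof.
move=> I0 /fine_cvgP[hfin hcvg].
have hpos : \forall l \near +oo, 0 < h l.
  near=> l.
  have l0 : 0 < l by near: l; exact: nbhs_pinfty_gt.
  have : log_rate (fun l => (h l)%:E) l \is a fin_num by near: l; exact: hfin.
  rewrite /log_rate /=; case: ifPn; last by rewrite -ltNge.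
  by rewrite gt0_muleNy// lte_fin invr_gt0.
split=> // c c0; near=> l.
have l0 : 0 < l by near: l; exact: nbhs_pinfty_gt.
have hl0 : 0 < h l by near: l; exact: hpos.
have : fine (log_rate (fun l => (h l)%:E) l) < - (I / 2).
  by near: l; apply: (cvgr_lt _ hcvg); lra.
rewrite /log_rate /= leNgt hl0 /= ltr_pdivrMl// => lnh.
(* Then [1 / c <= I / 2 * l < expR (I / 2 * l)], while [h l] lies below the inverse of this
   exponential. *)
have lc : 2 / (I * c) <= l by near: l; apply: nbhs_pinfty_ge; rewrite num_real.
rewrite -ltr_ln ?posrE//; apply: (lt_trans lnh).
rewrite mulrN ltrNl -lnV ?posrE//.
rewrite -ltr_expR lnK ?posrE ?invr_gt0//.
apply: lt_le_trans (expR_ge1Dx _).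
rewrite ler_pdivrMr ?mulr_gt0// in lc.
rewrite -[c^-1]mul1r ltr_pdivrMr//; nra.
Unshelve. all: end_near. Qed.

(* The minimal value is nondecreasing in the penalty weight, and the weight is
   eventually at least [gamma l1] since the target risk tends to 0. *)
Lemma min_value_lower_bound (xstar : R -> 'rV[R]_n) (I : R) :
  (forall x, 0 <= p x) -> (forall x, 0 <= f x) ->
  (forall l, 0 < l -> 0 < gamma l) ->
  (forall l, 0 < l ->
     is_minimizer [set: 'rV[R]_n] (objective f p gamma l) (xstar l)) ->
  ldp_target_risk p gamma xstar I ->
  exists2 c, 0 < c & \forall l \near +oo, c <= objective f p gamma l (xstar l).
Proof.
move=> p0 f0 g0 xmin [I0 hcvg _].
have [hpos hsmall] := log_rate_cvg_neg I0 hcvg.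
have [l1 [l1_gt0 pl1]] : exists l1, 0 < l1 /\ 0 < p (xstar l1).
  have : \forall l \near +oo, 0 < l /\ 0 < p (xstar l).
    by near=> l; split; near: l => //; exact: nbhs_pinfty_gt.
  by move=> /filter_ex.
exists (objective f p gamma l1 (xstar l1)).
  by rewrite /objective ltr_wpDl// mulr_gt0// g0.
near=> l.
have l0 : 0 < l by near: l; exact: nbhs_pinfty_gt.
have pl : p (xstar l) < p (xstar l1) by near: l; exact: hsmall.
(* Exchange argument: the sum of the two minimality inequalities is [0 <= (gamma l - gamma l1) * (p
   (xstar l1) - p (xstar l))], so [gamma l1 <= gamma l]. *)
have := (xmin _ l1_gt0).2 (xstar l) Logic.I.
have := (xmin _ l0).2 (xstar l1) Logic.I.
have := p0 (xstar l); rewrite /objective; nra.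
Unshelve. all: end_near. Qed.

(** [f] grows at most quadratically in the distance to [xt]; in [gamma l * p (x0 l)] the opposite
    rates [I] and [- I] cancel. *)
Lemma subexp_initial_objective (x0 : R -> 'rV[R]_n) (xt : 'rV[R]_n) (I : R) :
  (forall x, 0 <= p x) -> (forall l, 0 < l -> 0 < gamma l) ->
  (limsup_log_rate (fun l => (gamma l)%:E) <= I%:E)%E ->
  smooth_convex_loss f -> safe_start p x0 I -> subexp_initial_distance x0 xt ->
  subexp (fun l => objective f p gamma l (x0 l)).
Proof.
move=> p0 g0 hg [f_C2 f_cvx [Lf Lf0 f_hess]] hp hd.
have sd : subexp (fun l => enorm (x0 l - xt)).
  by move=> delta d0; have := limsup_log_rate_expR hd d0; rewrite add0r.
apply: subexpD.
  apply: (@subexp_le _ _ (fun l => `|f xt| +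
      (enorm (grad f xt) + Lf * enorm (x0 l - xt)) * enorm (x0 l - xt))).
    apply: nearW => l; have [df _ _] := f_C2.
    have := convex_grad_le xt f_cvx (df (x0 l)).
    have := dot_le (grad f (x0 l)) (x0 l - xt).
    have := ler_wpM2r (enorm_ge0 (x0 l - xt))
      (grad_lipschitz_at xt (x0 l) (ltW Lf0) f_C2 f_hess).
    have := ler_norm (f xt); rewrite !dotBr; lra.
  have d0 l : 0 <= enorm (x0 l - xt) by exact: enorm_ge0.
  have c0 l : 0 <= enorm (grad f xt) + Lf * enorm (x0 l - xt).
    by rewrite addr_ge0 ?enorm_ge0 ?mulr_ge0// ltW.
  apply: subexpD; first exact: subexp_cst.
  apply: subexpM => //; apply: subexpD; first exact: subexp_cst.
  by apply: subexpM => // [_|]; [exact: ltW|exact: subexp_cst].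
move=> delta d0; have d2 : 0 < delta / 2 by rewrite divr_gt0.
near=> l.
have l0 : 0 < l by near: l; exact: nbhs_pinfty_gt.
have gl : gamma l <= expR ((I + delta / 2) * l).
  by near: l; exact: limsup_log_rate_expR.
have pl : p (x0 l) <= expR ((- I + delta / 2) * l).
  by near: l; exact: (limsup_log_rate_expR hp).
apply: (le_trans (ler_pM (ltW (g0 _ l0)) (p0 _) gl pl)).
by rewrite -expRD le_eqVlt; apply/orP; left; apply/eqP; congr expR; field.
Unshelve. all: end_near. Qed.

Lemma grad_objective l x : differentiable f x -> differentiable p x ->
  grad (objective f p gamma l) x = grad f x + gamma l *: grad p x.
Proof.
move=> df dp; apply/rowP => i; rewrite !mxE.
have -> : objective f p gamma l = f + gamma l *: p by apply/funext.
rewrite deriveD; first by rewrite deriveZ//; exact: diff_derivable.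
- exact: diff_derivable.
- by apply: derivableZ; exact: diff_derivable.
Qed.

Lemma differentiable_objective l x : differentiable f x -> differentiable p x ->
  differentiable (objective f p gamma l) x.
Proof.
move=> df dp; have -> : objective f p gamma l = f + gamma l *: p by apply/funext.
by apply: differentiableD => //; exact: differentiableZ.
Qed.

Lemma measurable_grad : (forall x, differentiable (grad f) x) ->
  measurable_fun [set: g_sigma_algebraType (@open 'rV[R]_n)]
    (grad f : g_sigma_algebraType (@open 'rV[R]_n) ->
      g_sigma_algebraType (@open 'rV[R]_n)).
Proof.
move=> dg; apply: rV_borel_measurable => i.
apply: continuous_borel_measurable => x.
apply: (@continuous_comp _ _ _ (grad f) (fun y : 'rV[R]_n => y 0 i)).
  exact: differentiable_continuous.
exact: coord_continuous.
Qed.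

End LogRates.


(** * Choice of the subexponential constants and assembly of the bounds *)

Theorem theorem1 (R : realType) (n : nat)
  (f p : 'rV[R]_n -> R) (gamma : R -> R)
  (xstar x0 : R -> 'rV[R]_n) (xt : 'rV[R]_n) (I : R)
  (d : measure_display) (S : measurableType d) (mu : R -> probability S R)
  (Gf : 'rV[R]_n -> S -> 'rV[R]_n) (Gp : R -> 'rV[R]_n -> S -> 'rV[R]_n)
  (p_ge0 : forall x, 0 <= p x)
  (gamma_gt0 : forall l : R, 0 < l -> 0 < gamma l)
  (xstar_min : forall l : R, 0 < l ->
     is_minimizer [set: 'rV[R]_n] (objective f p gamma l) (xstar l))
  (h_ldp : ldp_target_risk p gamma xstar I)
  (h_estimators : efficient_estimators f p mu Gf Gp)
  (h_safe_start : safe_start p x0 I)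
  (h_smooth_convex : smooth_convex_loss f)
  (h_sublevel : sublevel_bounded f)
  (xt_min : is_minimizer [set: 'rV[R]_n] f xt)
  (h_zero_min : f xt = 0)
  (h_relative : relative_bounds p xt)
  (h_convex : convex_objective f p gamma)
  (h_init_dist : subexp_initial_distance x0 xt)
  (alpha : R) (alpha_range : 0 <= alpha < 1)
  (AA : set (scheme R n))
  (AA_class : AA = class_last alpha \/ AA = class_avg alpha) :
  exists A : R -> scheme R n,
    (forall l : R, 0 < l -> AA (A l)) /\
    forall (d' : measure_display) (Omega : measurableType d')
      (P : R -> probability Omega R) (xi : R -> nat * nat -> Omega -> S),
      (forall l : R, 0 < l -> iid (P l) (mu l) (xi l)) ->
      efficient Gf Gp f p gamma [set: 'rV[R]_n] P xi xstar A x0.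
Proof.
have [I_gt0 _ gamma_rate] := h_ldp.
have [f_C2 f_cvx [Lf Lf_gt0 f_hess]] := h_smooth_convex.
have [df dgf _] := f_C2.
have [p_C2 [L1 [L2 [b1 [b2 [[L1_gt0 L2_gt0 b1_ge0 b2_ge0] p_rel]]]]]] := h_relative.
have [dp dgp _] := p_C2.
have [epsf [df0 [epsf_gt0 df_gt0 _ f_diam]]] := h_sublevel.
have [mGf mGp uGf uGp [sf [sp [sf_ge0 sp_ge0 varf varp sp_rate]]]] := h_estimators.
have f_ge0 x : 0 <= f x by rewrite -h_zero_min; apply: xt_min.2.
have /andP[alpha_ge0 alpha_lt1] := alpha_range.
have [c0 c0_gt0 c0_le] :=
  min_value_lower_bound p_ge0 f_ge0 gamma_gt0 xstar_min h_ldp.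
pose F l := objective f p gamma l.
(* Level of the sublevel set. It leaves room for [F (x0 l) + 1], dominates [sp l], and is at least
   [l], so that it tends to infinity. The absolute values keep all constants nonnegative also for
   [l <= 0]. *)
pose Q l := 1 + `|l| + `|F l (x0 l)| + `|sp l|.
have Q_ge1 l : 1 <= Q l by rewrite /Q -!addrA lerDl !addr_ge0.
have Q_ge0 l : 0 <= Q l := le_trans ler01 (Q_ge1 l).
have F_ge0 l x : 0 < l -> 0 <= F l x.
  by move=> l0; rewrite /F /objective addr_ge0// mulr_ge0// ltW// gamma_gt0.
have Q_sub : subexp Q.
  apply: subexpD; last first.
    move=> delta d0; have H := limsup_log_rate_expR sp_rate d0.
    near=> l; have l0 : 0 < l by near: l; exact: nbhs_pinfty_gt.
    by rewrite ger0_norm ?sp_ge0// -[delta]add0r; near: l; exact: H.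
  apply: subexpD; last first.
    apply: (@subexp_le _ _ (fun l => F l (x0 l))).
      near=> l; have l0 : 0 < l by near: l; exact: nbhs_pinfty_gt.
      by rewrite ger0_norm// F_ge0.
    apply: subexp_initial_objective p_ge0 gamma_gt0 _ h_smooth_convex
      h_safe_start h_init_dist.
    by rewrite gamma_rate.
  by apply: subexpD; [exact: subexp_cst|exact: subexp_normr].
pose mb := Num.bound (b1 + b2).
pose D0 l := 2 * df0 * (1 + Q l / epsf).
pose P1 l := 1 + (D0 l + 1) ^+ mb.
pose LP l := L1 * P1 l * Q l.
pose Gam l := enorm (grad f xt) + Lf * D0 l + LP l.
pose V l := 2 * sf ^+ 2 + 2 * (Q l * LP l) ^+ 2.
pose L l := Lf + 2 * (L2 * P1 l * Q l).
(* A sum of nonnegative terms dominates each of them. [2 * D0 l] appears because distances are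
   measured from [xstar l], with both points within [D0 l] of [xt]. *)
pose K l := Q l + (Gam l + 1) + (1 + 2 * (L1 * P1 l)) + 2 * L l + 2 * D0 l + V l.
have D0_ge0 l : 0 <= D0 l.
  by rewrite mulr_ge0 ?addr_ge0 ?divr_ge0 ?(ltW epsf_gt0)// mulr_ge0 ?(ltW df_gt0).
have P1_ge0 l : 0 <= P1 l by rewrite addr_ge0// exprn_ge0// addr_ge0.
have LP1_ge0 l : 0 <= L1 * P1 l by rewrite mulr_ge0 ?(ltW L1_gt0).
have LP_ge0 l : 0 <= LP l by rewrite mulr_ge0.
have Gam_ge0 l : 0 <= Gam l.
  by rewrite !addr_ge0 ?enorm_ge0// mulr_ge0 ?(ltW Lf_gt0).
have V_ge0 l : 0 <= V l by rewrite addr_ge0// mulr_ge0 ?sqr_ge0.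
have LPQ_ge0 l : 0 <= L2 * P1 l * Q l by rewrite !mulr_ge0 ?(ltW L2_gt0).
have L_ge0 l : 0 <= L l by rewrite addr_ge0 ?(ltW Lf_gt0)// mulr_ge0.
have K_ge l : [/\ Q l <= K l, Gam l + 1 <= K l, 1 + 2 * (L1 * P1 l) <= K l,
    2 * L l <= K l & 2 * D0 l <= K l] /\ V l <= K l.
  have := (Q_ge0 l, Gam_ge0 l, LP1_ge0 l, L_ge0 l, (D0_ge0 l, V_ge0 l)).
  by move=> [[[[? ?] ?] ?] [? ?]]; rewrite /K; do !split; lra.
have K_ge1 l : 1 <= K l by apply: (le_trans (Q_ge1 l)); have [[]] := K_ge l.
have K_gt0 l : 0 < K l := lt_le_trans ltr01 (K_ge1 l).
have D0_sub : subexp D0.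
  apply: subexpM => [_|l||]; rewrite ?mulr_ge0 ?(ltW df_gt0)//.
  - by rewrite addr_ge0// divr_ge0// ltW.
  - exact: subexp_cst.
  apply: subexpD; first exact: subexp_cst.
  by apply: subexpM => // [_|]; [rewrite invr_ge0 ltW|exact: subexp_cst].
have P1_sub : subexp P1.
  apply: subexpD; first exact: subexp_cst.
  apply: subexpX => [l|]; first by rewrite addr_ge0.
  by apply: subexpD => //; exact: subexp_cst.
have LP1_sub : subexp (fun l => L1 * P1 l) by apply: subexpZ; rewrite ?ltW.
have LP_sub : subexp LP by exact: subexpM.
have Gam_sub : subexp Gam.
  apply: subexpD => //; apply: subexpD; first exact: subexp_cst.
  by apply: subexpZ; rewrite ?ltW.
have V_sub : subexp V.
  apply: subexpD; first exact: subexp_cst.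
  apply: subexpZ => // [l|]; first exact: sqr_ge0.
  by apply: subexpX => [l|]; [rewrite mulr_ge0|exact: subexpM].
have L_sub : subexp L.
  apply: subexpD; first exact: subexp_cst.
  apply: subexpZ => //; apply: subexpM => // [l|].
    by rewrite mulr_ge0 ?(ltW L2_gt0).
  by apply: subexpZ; rewrite ?ltW.
have K_sub : subexp K.
  do !(apply: subexpD => //); try exact: subexp_cst; exact: subexpZ.
pose m := Num.bound (5 / (1 - alpha)).
have m_large : 5 <= m%:R * (1 - alpha).
  have a1 : 0 < 1 - alpha by rewrite subr_gt0.
  by rewrite -ler_pdivrMr// ltW// archi_boundP// divr_ge0// ltW.
(* Truncation plus one is at least its argument, as the level bounds require, and at most one more,
   which keeps [T l * B l] subexponential. *)
pose T l := (Num.trunc (K l ^+ m)).+1.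
pose B l := (Num.trunc ((T l)%:R ^+ 3 * K l ^+ 6)).+1.
have trunc_le (x : R) : 0 <= x -> x <= (Num.trunc x).+1%:R <= x + 1.
  move=> x_ge0; have /andP[H1 H2] := truncn_itv x_ge0.
  by rewrite (ltW H2) -natr1 lerD2r H1.
have Km_ge0 l : 0 <= K l ^+ m by rewrite exprn_ge0// ltW.
have TK_ge0 l : 0 <= (T l)%:R ^+ 3 * K l ^+ 6 by rewrite mulr_ge0// exprn_ge0// ltW.
have TB_sub : subexp (fun l => (T l * B l)%:R).
  pose U l := K l ^+ m + 1.
  have U_ge0 l : 0 <= U l by rewrite addr_ge0.
  have K6_ge0 l : 0 <= K l ^+ 6 by rewrite exprn_ge0// ltW.
  have UK_ge0 l : 0 <= U l ^+ 3 * K l ^+ 6 by rewrite mulr_ge0// exprn_ge0.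
  have K_ge0 l : 0 <= K l by exact: ltW.
  apply: (@subexp_le _ _ (fun l => U l * (U l ^+ 3 * K l ^+ 6 + 1))).
    apply: nearW => l; rewrite natrM.
    have /andP[_ TU] := trunc_le _ (Km_ge0 l).
    have /andP[_ BU] := trunc_le _ (TK_ge0 l).
    apply: ler_pM => //; apply: (le_trans BU); rewrite lerD2r ler_wpM2r//.
    by rewrite lerXn2r ?nnegrE.
  have U_sub : subexp U by apply: subexpD; [exact: subexpX|exact: subexp_cst].
  apply: subexpM => // [l|]; first by rewrite addr_ge0.
  apply: subexpD; last exact: subexp_cst.
  by apply: subexpM => // [l||]; rewrite ?exprn_ge0//; exact: subexpX.
pose eta l (t : nat) := (K l ^+ 2)^-1 * (1 + t%:R) `^ (- alpha).
have main (A : R -> scheme R n) : (forall l, stepsize (A l) = eta l) ->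
    (forall l, batch (A l) = B l) ->
    (forall l, output (A l) = @last_output R n \/
       output (A l) = avg_output (stepsize (A l))) ->
    forall (d' : measure_display) (Omega : measurableType d')
      (P : R -> probability Omega R) (xi : R -> nat * nat -> Omega -> S),
    (forall l : R, 0 < l -> iid (P l) (mu l) (xi l)) ->
    efficient Gf Gp f p gamma [set: 'rV[R]_n] P xi xstar A x0.
  move=> AE AB AO d' Omega P xi xi_iid eps kappa eps_gt0 /andP[kappa_gt0 kappa_lt1].
  apply: limsup_log_rate_le0 => delta delta_gt0.
  near=> l.
  have l_gt0 : 0 < l by near: l; exact: nbhs_pinfty_gt.
  have TBl : (T l * B l)%:R <= expR (delta * l) by near: l; exact: TB_sub.
  apply: (@le_trans _ _ ((T l * B l)%:R)%:E); last by rewrite lee_fin.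
  apply: ereal_inf_lbound; exists (T l); last by rewrite AB.
  rewrite /=.
  have l_le : l <= K l.
    have [[QK _ _ _ _] _] := K_ge l; apply: le_trans QK.
    by rewrite /Q gtr0_norm// [1 + l]addrC -!addrA lerDl !addr_ge0.
  (* As [l <= K l], this threshold gives [1 / K l <= kappa], and the next one gives
     [3 / K l <= eps * c0], which is at most [eps] times the minimal value. *)
  have kl : kappa^-1 <= l by near: l; apply: nbhs_pinfty_ge; rewrite num_real.
  have el : 3 / (eps * c0) <= l by near: l; apply: nbhs_pinfty_ge; rewrite num_real.
  have cl : c0 <= F l (xstar l) by near: l.
  apply: (@le_trans _ _ (1 - (K l)^-1)%:E).
    by rewrite lee_fin lerD2l lerN2 invf_ple ?posrE// (le_trans kl).
  have gl := gamma_gt0 l l_gt0.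
  have [[QK GK PK LK DK] VK] := K_ge l.
  have sublevel_D x : F l x <= Q l -> enorm (x - xt) <= D0 l.
    move=> Fx; apply: (le_trans (sublevel_distance f_cvx h_zero_min epsf_gt0
      df_gt0 f_diam (f_ge0 x))).
    rewrite ler_wpM2l ?mulr_ge0 ?(ltW df_gt0)// lerD2l ler_wpM2r ?invr_ge0 ?(ltW epsf_gt0)//.
    by apply: le_trans Fx; rewrite /F /objective lerDl mulr_ge0// ltW.
  have rel_le x b : 0 <= b -> b <= b1 + b2 -> enorm (x - xt) <= D0 l + 1 ->
      1 + enorm (x - xt) `^ b <= P1 l.
    move=> b_ge0 bb xD; rewrite lerD2l.
    apply: powR_le_exprn => //; rewrite ?enorm_ge0 ?lerDr//.
    by rewrite (le_trans bb)// ltW// archi_boundP// addr_ge0.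
  have p_grad x : enorm (x - xt) <= D0 l + 1 ->
      enorm (grad p x) <= L1 * P1 l * p x.
    move=> xD; apply: (le_trans (p_rel x).1); rewrite ler_wpM2r// ler_wpM2l ?(ltW L1_gt0)//.
    by apply: rel_le => //; rewrite lerDl.
  have p_hess x : enorm (x - xt) <= D0 l + 1 ->
      specnorm (hess p x) <= L2 * P1 l * p x.
    move=> xD; apply: (le_trans (p_rel x).2); rewrite ler_wpM2r// ler_wpM2l ?(ltW L2_gt0)//.
    by apply: rel_le => //; rewrite lerDr.
  have F_x0 : F l (x0 l) + 1 <= Q l.
    rewrite /Q addrC -addrA -addrA lerD2l addrCA; apply: (le_trans (ler_norm _)).
    by rewrite lerDl addr_ge0.
  have F_xs : F l (xstar l) <= Q l.
    apply: le_trans F_x0; rewrite (le_trans ((xstar_min l l_gt0).2 (x0 l) Logic.I))//.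
    by rewrite lerDl.
  pose g x := grad f x + gamma l *: grad p x.
  have mg := measurable_rVD (measurable_grad dgf)
    (measurable_rVZ (measurable_cst (gamma l)) (measurable_grad dgp)).
  have mFl : measurable_fun [set: g_sigma_algebraType (@open 'rV[R]_n)] (F l).
    apply: continuous_borel_measurable => x.
    by apply: differentiable_continuous; exact: differentiable_objective.
  have mG : jointly_measurable (fun y s => Gf y s + gamma l *: Gp l y s).
    move=> i; under eq_fun do rewrite !mxE.
    apply: measurable_funD; first exact: mGf.
    by apply: measurable_funM; [exact: measurable_cst|exact: mGp].
  have g_subgrad a b : F l a + dot (g a) (b - a) <= F l b.
    rewrite /g -grad_objective//; apply: convex_grad_le; first exact: h_convex.
    exact: differentiable_objective.
  have g_bounded a : F l a <= Q l -> enorm (g a) <= Gam l.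
    exact: (level_grad gl f_ge0 f_C2 (ltW Lf_gt0) (ltW L1_gt0) (P1_ge0 l)
      f_hess p_grad sublevel_D).
  have descent a v : F l a <= Q l -> enorm v <= (1 + 2 * (L1 * P1 l))^-1 ->
      F l (a + v) <= F l a + dot (g a) v + L l * enorm v ^+ 2.
    exact: (level_descent gl f_ge0 p_ge0 f_C2 p_C2 (ltW Lf_gt0) (ltW L1_gt0)
      (ltW L2_gt0) (P1_ge0 l) f_hess p_grad p_hess sublevel_D).
  have sublevel_dist a : F l a <= Q l -> enorm (a - xstar l) <= 2 * D0 l.
    move=> Fa.
    have -> : a - xstar l = (a - xt) - (xstar l - xt) by rewrite opprB addrA subrK.
    apply: (le_trans (enormB _ _)).
    by rewrite mulr_natl mulr2n lerD// sublevel_D.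
  have variance y a : F l y <= Q l ->
      (\int[mu l]_s (enorm (a + (Gf y s + gamma l *: Gp l y s - g y)) ^+ 2)%:E <=
       (enorm a ^+ 2 + V l)%:E)%E.
    move=> Fy.
    have mGfy i : measurable_fun [set: S] (fun s => Gf y s 0 i).
      exact: (measurableT_comp (mGf i)
        (pair1_measurable (y : g_sigma_algebraType (@open 'rV[R]_n)))).
    have mGpy i : measurable_fun [set: S] (fun s => Gp l y s 0 i).
      exact: (measurableT_comp (mGp l l_gt0 i)
        (pair1_measurable (y : g_sigma_algebraType (@open 'rV[R]_n)))).
    apply: centered_second_moment => [i||].
    - under eq_fun do rewrite !mxE.
      by apply: measurable_funD => //; apply: measurable_funM.
    - by apply: unbiased_lincomb; [exact: uGf|exact: uGp].
    have := varf l y l_gt0; have := varp l y l_gt0; rewrite unlock => vp vf.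
    apply: le_trans (lincomb_second_moment (gamma l) mGfy mGpy vf vp) _.
    rewrite lee_fin lerD2l ler_wpM2l// -!exprMn.
    (* The noise of [Gp] is relative to the gradient of [p], so the weight can be paired with that
       gradient and only [sp l <= Q l] remains as a factor. *)
    have gp : gamma l * enorm (grad p y) <= LP l.
      exact: (level_grad_p gl f_ge0 (ltW L1_gt0) (P1_ge0 l) p_grad sublevel_D).
    rewrite lerXn2r ?nnegrE ?(mulr_ge0 (Q_ge0 l) (LP_ge0 l))//.
      by rewrite !mulr_ge0 ?enorm_ge0 ?sp_ge0 ?(ltW gl).
    have -> : gamma l * (sp l * enorm (grad p y)) = sp l * (gamma l * enorm (grad p y)).
      by ring.
    rewrite ler_pM ?mulr_ge0 ?enorm_ge0 ?sp_ge0 ?(ltW gl)//.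
    by rewrite (le_trans (ler_norm _))// /Q lerDr !addr_ge0.
  have /andP[T_large _] := trunc_le _ (Km_ge0 l).
  have /andP[B_large _] := trunc_le _ (TK_ge0 l).
  apply: (level_success (xi_iid l l_gt0) mFl mg mG g_subgrad descent g_bounded
    sublevel_dist variance (V_ge0 l) (L_ge0 l) _ alpha_ge0 alpha_lt1 (K_ge1 l)
    F_x0 GK _ LK DK VK m_large T_large (AE l) _ (AO l)).
  - by rewrite mulr_ge0.
  - by rewrite lef_pV2 ?posrE// (lt_le_trans ltr01)// lerDl mulr_ge0.
  - by rewrite AB.
  rewrite [leRHS]mulrDl mul1r lerD2l.
  apply: (@le_trans _ _ (eps * c0)); last by rewrite ler_wpM2l// ltW.
  rewrite ler_pdivrMr// mulrC -ler_pdivrMr ?mulr_gt0//.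
  exact: le_trans el l_le.
have poly_eta l out : poly_steps alpha (Scheme (eta l) (B l) out).
  by exists (K l ^+ 2)^-1 => //; rewrite invr_gt0 exprn_gt0.
case: AA_class => ->.
- exists (fun l => Scheme (eta l) (B l) (@last_output R n)); split=> [l _|].
    by split.
  by apply: main => // l; left.
- exists (fun l => Scheme (eta l) (B l) (avg_output (eta l))); split=> [l _|].
    by split.
  by apply: main => // l; right.
Unshelve. all: end_near. Qed.
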